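(* Let $p$ and $q$ be odd prime numbers such that $p\mid q-1$. Let $u$ denote a fixed element of order $p$ in $(\mathbf Z/(q^2))^*$. If $p^2\mid q-1$, let $u'$ denote a fixed element of order $p^2$ in $(\mathbf Z/(q^2))^*$. 1) On $\mathbf Z/(q^2)\times\mathbf Z/(p^2)$ define the operation $$(a,b)\cdot(a',b')=(a+u^ba',\,b+b'),\quad a,a'\in\mathbf Z/(q^2),\ b,b'\in\mathbf Z/(p^2).$$ a) Assume $p^2\nmid q-1$. Then there are $2p^2+2p$ skew braces, up to isomorphism, with additive group $(\mathbf Z/(q^2)\times\mathbf Z/(p^2),\cdot)$, whose multiplicative laws are given by - $(a,b)\circ(a',b')=(a+u^{\ell b}a',\,b+b')$, $0\le\ell\le p-1$; - $(a,b)\circ(a',b')=(a+u^{\ell kb}a',\,b+b'+kpbb')$, $0\le\ell\le p-1$, $1\le k\le p-1$; - $(a,b)\circ(a',b')=(u^{b'}a+u^{\ell b}a',\,b+b')$, $0\le\ell\le p-1$; - $(a,b)\circ(a',b')=(u^{b'}a+u^{\ell kb}a',\,b+b'+kpbb')$, $0\le\ell\le p-1$, $1\le k\le p-1$; - $(a,b)\circ(a',b')=(a+a'+qaa',\,b+b'+kpbb')$, $0\le k\le p-1$; - $(a,b)\circ(a',b')=(u^{b'}a+u^{b}a'+qaa',\,b+b')$; - $(a,b)\circ(a',b')=(u^{b'}a+u^{kb}a'+qaa',\,b+b'+kpbb')$, $1\le k\le p-1$. b) Assume $p^2\mid q-1$. Then there are $4p^2$ skew braces, up to isomorphism, with additive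 group $(\mathbf Z/(q^2)\times\mathbf Z/(p^2),\cdot)$. These are the ones with the multiplicative laws listed in a) and, in addition, those whose multiplicative laws are given by - $(a,b)\circ(a',b')=(a+u'^{\ell b}a',\,b+b')$, $1\le\ell\le p-1$; - $(a,b)\circ(a',b')=(a+u'^{\ell(kb-pkb(kb-1)/2)}a',\,b+b'+kpbb')$, $1\le\ell\le p-1$, $1\le k\le p-1$; - $(a,b)\circ(a',b')=(u^{b'}a+u'^{\ell b}a',\,b+b')$, $1\le\ell\le p-1$; - $(a,b)\circ(a',b')=(u^{b'}a+u'^{\ell(kb-pkb(kb-1)/2)}a',\,b+b'+kpbb')$, $1\le\ell\le p-1$, $1\le k\le p-1$. 2) If $p^2\mid q-1$, on $\mathbf Z/(q^2)\times\mathbf Z/(p^2)$ define the operation $$(a,b)\cdot(a',b')=(a+u'^ba',\,b+b'),\quad a,a'\in\mathbf Z/(q^2),\ b,b'\in\mathbf Z/(p^2).$$ Then there are $2p^2+2$ skew braces, up to isomorphism, with additive group $(\mathbf Z/(q^2)\times\mathbf Z/(p^2),\cdot)$, whose multiplicative laws are given by - $(a,b)\circ(a',b')=(a+u'^{\ell b}a',\,b+b')$, $0\le\ell\le p^2-1$; - $(a,b)\circ(a',b')=(u'^{b'}a+u'^{\ell b}a',\,b+b')$, $0\le\ell\le p^2-1$; - $(a,b)\circ(a',b')=(a+a'+qaa',\,b+b')$; - $(a,b)\circ(a',b')=(u'^{b'}a+u'^{b}a'+qaa',\,b+b')$.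
   Context: A skew (left) brace is a set $B$ with two operations $\cdot,\circ$ such that $(B,\cdot)$ (additive group) and $(B,\circ)$ (multiplicative group) are groups and $x\circ(y\cdot z)=(x\circ y)\cdot x^{-1}\cdot(x\circ z)$ for all $x,y,z\in B$, where $x^{-1}$ is the inverse in $(B,\cdot)$. Two skew braces are isomorphic if there is a bijection between them preserving both operations. In each part, the listed laws are meant as a list of representatives of the isomorphism classes of skew braces with the given additive group. Exponents of $u$ and $u'$ are residue classes in $\mathbf Z/(p^2)$, which is meaningful since $u^{p}=1$ and $u'^{p^2}=1$; division by $2$ is in $\mathbf Z/(p^2)$. In the description of the multiplicative laws, the isomorphism $b\mapsto kb-pkb(kb-1)/2$ from the group $\mathbf Z/(p^2)$ with operation $b\circ_k b'=b+b'+kpbb'$ to the additive group $\mathbf Z/(p^2)$ has been taken into account where appropriate.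
   Formalization: In the last family of 1a) (also used in 1b)), the coefficient u^{kb} of a' is replaced by u^b, for 1≤k≤p-1: with u^{kb} the operation is not associative for k≥2 (the aa'' terms q u^{b'} and q u^{kb'} differ). *)

(* Defs.v *)
From HB Require Import structures.
From mathcomp Require Import all_boot all_order all_fingroup all_algebra.

Set Implicit Arguments.
Unset Strict Implicit.
Unset Printing Implicit Defensive.

Import GRing.Theory.
Local Open Scope ring_scope.

Definition group_axioms (T : Type) (op : T -> T -> T) (e : T) (inv : T -> T) :
    Prop :=
  [/\ associative op, left_id e op, right_id e op,
      left_inverse e inv op & right_inverse e inv op].

Definition is_group (T : Type) (op : T -> T -> T) : Prop :=
  exists e inv, group_axioms op e inv.

(* The operations are kept as plain functions: the products carrying them below
   already have canonical (abelian) group structures, different from both. *)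
Definition is_skew_brace (T : Type) (add mul : T -> T -> T) : Prop :=
  is_group mul /\
  exists e inv, group_axioms add e inv /\
    forall x y z, mul x (add y z) = add (add (mul x y) (inv x)) (mul x z).

Definition group_iso (T1 T2 : Type)
    (op1 : T1 -> T1 -> T1) (op2 : T2 -> T2 -> T2) : Prop :=
  exists f : T1 -> T2, bijective f /\ {morph f : x y / op1 x y >-> op2 x y}.

Definition skew_brace_iso (T1 T2 : Type)
    (add1 mul1 : T1 -> T1 -> T1) (add2 mul2 : T2 -> T2 -> T2) : Prop :=
  exists f : T1 -> T2,
    [/\ bijective f, {morph f : x y / add1 x y >-> add2 x y}
      & {morph f : x y / mul1 x y >-> mul2 x y}].

(* Up to isomorphism there are exactly N skew braces with additive group
   (T, add), and the entries of [laws] are their multiplicative laws, each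
   class being represented exactly once. *)
Definition classifies (T : Type) (add : T -> T -> T) (N : nat)
    (laws : seq (T -> T -> T)) : Prop :=
  [/\ size laws = N,
      forall i, (i < N)%N -> is_skew_brace add (nth add laws i),
      forall i j, (i < j < N)%N ->
        ~ skew_brace_iso add (nth add laws i) add (nth add laws j)
    & forall (S : Type) (addS mulS : S -> S -> S),
        is_skew_brace addS mulS -> group_iso addS add ->
        exists2 i, (i < N)%N
          & skew_brace_iso addS mulS add (nth add laws i)].

(* The exponent acts through its representative in [0, m); this does not depend
   on the representative as soon as the order of u divides m, which holds in
   every use below. *)
Definition zpow (n m : nat) (u : {unit 'Z_n}) (e : 'Z_m) : 'Z_n :=
  val (u ^+ (e : nat))%g.

Notation "u ^^ e" := (zpow u e) (at level 29, left associativity).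

Section Laws.

Variables p q : nat.

Definition carrier : Type := ('Z_(q ^ 2) * 'Z_(p ^ 2))%type.

Implicit Types u v : {unit 'Z_(q ^ 2)}.

Definition twisted_add u : carrier -> carrier -> carrier :=
  fun '(a, b) '(a', b') => (a + u ^^ b * a', b + b').

(* The exponent of v in the laws whose second component is b + b' + k p b b'. *)
Definition kexp (k : nat) (b : 'Z_(p ^ 2)) : 'Z_(p ^ 2) :=
  k%:R * b - p%:R * (k%:R * b) * (k%:R * b - 1) / 2%:R.

(* In the last family the coefficient of a' is u ^^ b: with u ^^ (k%:R * b)
   instead, the operation is associative only for k = 1. *)
Definition laws_order_p u : seq (carrier -> carrier -> carrier) :=
  [seq (fun '(a, b) '(a', b') => (a + u ^^ (l%:R * b) * a', b + b'))
     | l <- iota 0 p]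
  ++
  [seq (fun '(a, b) '(a', b') =>
          (a + u ^^ (l%:R * k%:R * b) * a', b + b' + k%:R * p%:R * b * b'))
     | l <- iota 0 p, k <- iota 1 p.-1]
  ++
  [seq (fun '(a, b) '(a', b') =>
          (u ^^ b' * a + u ^^ (l%:R * b) * a', b + b'))
     | l <- iota 0 p]
  ++
  [seq (fun '(a, b) '(a', b') =>
          (u ^^ b' * a + u ^^ (l%:R * k%:R * b) * a',
           b + b' + k%:R * p%:R * b * b'))
     | l <- iota 0 p, k <- iota 1 p.-1]
  ++
  [seq (fun '(a, b) '(a', b') =>
          (a + a' + q%:R * a * a', b + b' + k%:R * p%:R * b * b'))
     | k <- iota 0 p]
  ++
  [:: fun '(a, b) '(a', b') =>
          (u ^^ b' * a + u ^^ b * a' + q%:R * a * a', b + b')]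
  ++
  [seq (fun '(a, b) '(a', b') =>
          (u ^^ b' * a + u ^^ b * a' + q%:R * a * a',
           b + b' + k%:R * p%:R * b * b'))
     | k <- iota 1 p.-1].

Definition laws_order_p_extra u v : seq (carrier -> carrier -> carrier) :=
  [seq (fun '(a, b) '(a', b') => (a + v ^^ (l%:R * b) * a', b + b'))
     | l <- iota 1 p.-1]
  ++
  [seq (fun '(a, b) '(a', b') =>
          (a + v ^^ (l%:R * kexp k b) * a', b + b' + k%:R * p%:R * b * b'))
     | l <- iota 1 p.-1, k <- iota 1 p.-1]
  ++
  [seq (fun '(a, b) '(a', b') =>
          (u ^^ b' * a + v ^^ (l%:R * b) * a', b + b'))
     | l <- iota 1 p.-1]
  ++
  [seq (fun '(a, b) '(a', b') =>
          (u ^^ b' * a + v ^^ (l%:R * kexp k b) * a',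
           b + b' + k%:R * p%:R * b * b'))
     | l <- iota 1 p.-1, k <- iota 1 p.-1].

Definition laws_order_p2 v : seq (carrier -> carrier -> carrier) :=
  [seq (fun '(a, b) '(a', b') => (a + v ^^ (l%:R * b) * a', b + b'))
     | l <- iota 0 (p ^ 2)]
  ++
  [seq (fun '(a, b) '(a', b') =>
          (v ^^ b' * a + v ^^ (l%:R * b) * a', b + b'))
     | l <- iota 0 (p ^ 2)]
  ++
  [:: fun '(a, b) '(a', b') => (a + a' + q%:R * a * a', b + b');
      fun '(a, b) '(a', b') =>
        (v ^^ b' * a + v ^^ b * a' + q%:R * a * a', b + b')].

End Laws.

(* Main.v *)
(* The action of an element on the additive group has the form
   (a, b) |-> (al a + c (1 - E b), be b), where E b is the power of u twisting
   the addition. On N = Z/q^2 x 0 and on the quotient Z/p^2 the multiplicative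
   law is x + x' + r k x x', since a map be with values in 1 + r Z/r^2 and
   be (x + be x x') = be x be x' is affine. Averaging the orbits of an
   element of order p^2 gives two successive fixed points, hence a
   complement of N that is closed under both laws; after a shear it is
   0 x Z/p^2, and c vanishes there. On N, c is linear, c a = gam a, and
   conjugating N by the complement forces gam (1 + gam) = 0. The two roots
   0 and -1 of this equation are the two families of laws, with coefficient 1,
   resp. E b', in front of a. The remaining data are the term J a a',
   rescaled to 0 or q a a', the parameter k of Z/p^2, and a character of
   Z/p^2 with the operation b + b' + p k b b', up to the automorphisms b |-> be b
   that preserve E. *)
Require Import Defs.
From mathcomp Require Import all_boot all_order all_fingroup all_algebra.
From mathcomp Require Import all_solvable ring.
From Stdlib Require Import FunctionalExtensionality.

Set Implicit Arguments.
Unset Strict Implicit.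
Unset Printing Implicit Defensive.

Import GRing.Theory.
Local Open Scope ring_scope.

(** * Arithmetic of [Z/r^2]: torsion units and the operation [b + b' + r k b b'] *)

(* [R] is the ring [Z/r^2], for [r] prime. *)
Record Zsq (r : nat) (R : finComUnitRingType) : Prop := {
  Zsq_prime : prime r;
  Zsq_natP : forall x : R, exists n : nat, x = n%:R;
  Zsq_nat_eq0 : forall n, (n%:R == 0 :> R) = (r ^ 2 %| n)%N;
  Zsq_unit_nat : forall n, ((n%:R : R) \is a GRing.unit) = ~~ (r %| n)%N;
  Zsq_card : #|R| = (r ^ 2)%N }.

Lemma Zsq_Zp r : prime r -> Zsq r 'Z_(r ^ 2).
Proof.
move=> r_prime; have r2_gt1 : (1 < r ^ 2)%N.
  by rewrite -(exp1n 2) ltn_sqr prime_gt1.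
split=> // [x|n|n|]; first by exists x; rewrite natr_Zp.
- by rewrite -val_eqE /= val_Zp_nat // /dvdn.
- by rewrite unitZpE // coprime_pexpl // prime_coprime.
- by rewrite card_ord Zp_cast.
Qed.

Section LocalRing.

Variables (r : nat) (R : finComUnitRingType).
Hypothesis HR : Zsq r R.

Let r_prime : prime r := Zsq_prime HR.

Lemma Zsq_char : (r%:R : R) * r%:R = 0.
Proof. by apply/eqP; rewrite -natrM mulnn (Zsq_nat_eq0 HR). Qed.

Lemma Zsq_mod_nat n : (n %% r ^ 2)%:R = n%:R :> R.
Proof.
rewrite [in RHS](divn_eq n (r ^ 2)) natrD natrM.
by rewrite (eqP (_ : (r ^ 2)%:R == 0)) ?(Zsq_nat_eq0 HR) // mulr0 add0r.
Qed.

Lemma Zsq_nat_eq m n : (m%:R = n%:R :> R) -> m = n %[mod r ^ 2].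
Proof.
wlog le_mn : m n / (m <= n)%N => [hw mn|].
  by have [/hw->|/ltnW/hw->] := leqP m n.
move=> mn; apply/esym/eqP; rewrite eqn_mod_dvd // -(Zsq_nat_eq0 HR).
by rewrite natrB // mn subrr.
Qed.

Lemma Zsq_unitP (x : R) :
  reflect (exists y, x = r%:R * y) (x \isn't a GRing.unit).
Proof.
apply: (iffP idP) => [|[y ->]].
  have [n ->] := Zsq_natP HR x.
  rewrite (Zsq_unit_nat HR) negbK => /dvdnP[k ->].
  by exists k%:R; rewrite natrM mulrC.
have [n ->] := Zsq_natP HR y.
by rewrite -natrM (Zsq_unit_nat HR) dvdn_mulr ?negbK.
Qed.

Lemma Zsq_unit1D (x : R) : 1 + r%:R * x \is a GRing.unit.
Proof.
apply/negPn/negP => /Zsq_unitP[y yE].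
have: r%:R * (y - x) \isn't a (@GRing.unit R) by apply/Zsq_unitP; exists (y - x).
by rewrite mulrBr -yE addrK unitr1.
Qed.

Lemma Zsq_exp1D (x : R) n : (1 + r%:R * x) ^+ n = 1 + n%:R * (r%:R * x).
Proof.
elim: n => [|n IHn]; first by rewrite mul0r addr0.
have z := Zsq_char; rewrite exprS IHn -(natr1 n).
transitivity (1 + (n%:R + 1) * (r%:R * x) + (r%:R * r%:R) * (n%:R * x * x)); first by ring.
by rewrite z; ring.
Qed.

(** Torsion of order prime to [r] is detected modulo [r]: the quotient [x / y] has the form
    [1 + r z], its [n]-th power is [1 + n r z], and [n] is invertible. *)
Lemma Zsq_torsion_eq n (x y : R) : ~~ (r %| n)%N ->
  x ^+ n = 1 -> y ^+ n = 1 -> x - y \isn't a GRing.unit -> x = y.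
Proof.
move=> rn xn yn /Zsq_unitP[z zE].
have n_gt0 : (0 < n)%N by case: n rn {xn yn} => //; rewrite dvdn0.
have y_unit : y \is a GRing.unit by rewrite -(unitrX_pos y n_gt0) yn unitr1.
have xE : x / y = 1 + r%:R * (z / y).
  by rewrite mulrA -zE mulrBl divrr // addrC subrK.
have : (x / y) ^+ n = 1 by rewrite exprMn exprVn xn yn invr1 mulr1.
rewrite xE Zsq_exp1D => /(canRL (addKr _)); rewrite addrC subrr => nz.
have rz : r%:R * (z / y) = 0.
  by apply: (mulrI (_ : n%:R \is a GRing.unit)); rewrite ?(Zsq_unit_nat HR) // nz mulr0.
by rewrite -[x](divrK y_unit) xE rz addr0 mul1r.
Qed.

(** If [x - y] were a unit, [j] would vanish; so [x] and [y] agree modulo [r], which is enough for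
    torsion elements. *)
Lemma Zsq_torsion_eq_mul n (j x y : R) : ~~ (r %| n)%N ->
  x ^+ n = 1 -> y ^+ n = 1 -> j != 0 -> j * x = j * y -> x = y.
Proof.
move=> rn xn yn j0 jxy; apply: (Zsq_torsion_eq rn) => //.
apply: contraNN j0 => xy_unit; apply/eqP/(mulIr xy_unit).
by rewrite mul0r mulrBr jxy subrr.
Qed.

(** By Fermat's little theorem, used twice, [x ^+ (r ^ 2)] is congruent to [x] modulo [r]. *)
Lemma Zsq_pow_r2 (x : R) : x ^+ (r ^ 2) = 1 -> exists y, x = 1 + r%:R * y.
Proof.
move=> x1; have [n xE] := Zsq_natP HR x; rewrite xE in x1 *.
move: x1; rewrite -natrX -[1]/1%:R => nr; have {}nr := Zsq_nat_eq nr.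
have {}nr : n = 1 %[mod r].
  have : (n ^ (r ^ 2) = 1 %[mod r])%N.
    by rewrite -(@modn_dvdm (r ^ 2)) ?dvdn_exp // nr modn_dvdm ?dvdn_exp.
  by rewrite expnM !fermat_little.
have n_gt0 : (0 < n)%N.
  by case: (n) nr => //; rewrite mod0n modn_small ?prime_gt1.
have /dvdnP[k kE] : (r %| n - 1)%N by rewrite -eqn_mod_dvd // nr.
by exists k%:R; rewrite -{1}(subnKC n_gt0) kE natrD natrM [k%:R * _]mulrC.
Qed.

Hypothesis r_odd : odd r.

Lemma Zsq_unit2 : (2%:R : R) \is a GRing.unit.
Proof.
rewrite (Zsq_unit_nat HR); apply/negP; rewrite dvdn_prime2 // => /eqP r2.
by move: r_odd; rewrite r2.
Qed.

Lemma Zsq_half (x : R) : x / 2%:R * 2%:R = x.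
Proof. by rewrite divrK ?Zsq_unit2. Qed.

(* [1] generates the group with operation [b + b' + r k b b']. *)
Lemma circ_iter (k : R) n :
  iter n (fun b => 1 + b + r%:R * k * b) 0
  = n%:R + r%:R * k * n%:R * (n%:R - 1) / 2%:R.
Proof.
elim: n => [|n /= ->]; first by rewrite mulr0 !mul0r addr0.
apply: (mulIr Zsq_unit2); have z := Zsq_char.
rewrite -(natr1 n) [RHS]mulrDl Zsq_half.
set t := _ / 2%:R; have tE : t * 2%:R = r%:R * k * n%:R * (n%:R - 1) by exact: Zsq_half.
have rt : r%:R * t * 2%:R = 0 by rewrite -mulrA tE !mulrA z !mul0r.
transitivity (2%:R + n%:R * 2%:R + t * 2%:R + r%:R * k * n%:R * 2%:R + k * (r%:R * t * 2%:R)).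
  by ring.
by rewrite rt tE; ring.
Qed.

(** The formula of [circ_iter] is solved for [n]: its correction term is a multiple of [r], so the
    inverse differs only in the sign of that term. *)
Lemma circ_surj (k b : R) :
  exists n, iter n (fun b => 1 + b + r%:R * k * b) 0 = b /\
    n%:R = b - r%:R * k * b * (b - 1) / 2%:R.
Proof.
set t := r%:R * k * b * (b - 1) / 2%:R.
have z := Zsq_char.
have rt : r%:R * t = 0 by rewrite /t !mulrA z !mul0r.
have [n nE] := Zsq_natP HR (b - t); exists n; split => //.
rewrite circ_iter -nE; apply: (mulIr Zsq_unit2).
rewrite mulrDl Zsq_half.
have tE : t * 2%:R = r%:R * k * b * (b - 1) by exact: Zsq_half.
transitivity (b * 2%:R - t * 2%:R + r%:R * k * b * (b - 1) - r%:R * t * k * (b * 2%:R - 1 - t)).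
  by ring.
by rewrite tE rt; ring.
Qed.

Lemma circ_ind (P : R -> Prop) (k : R) :
  P 0 -> (forall b, P b -> P (1 + b + r%:R * k * b)) -> forall b, P b.
Proof.
move=> P0 PS b; have [n [<- _]] := circ_surj k b.
by elim: n => //= n; apply: PS.
Qed.

(** With [be 1 = 1 + r s], the value at the [n]-th iterate of 1 is [(1 + r s)^n = 1 + r s n]. By
    [circ_surj] every [b] is such an iterate with [n] congruent to [b] modulo [r], and
    [r ^ 2 = 0]. *)
Lemma brace_multiplier (be : R -> R) :
  (forall b, exists s, be b = 1 + r%:R * s) ->
  (forall b b', be (b + be b * b') = be b * be b') ->
  exists k, forall b, be b = 1 + r%:R * k * b.
Proof.
move=> be1 beM; have z := Zsq_char.
have be0 : be 0 = 1.
  have [s s0] := be1 0; have := beM 0 0.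
  rewrite mulr0 addr0 => /esym; rewrite -{3}[be 0]mulr1 => /mulrI; apply.
  by rewrite s0 Zsq_unit1D.
have [s s1] := be1 1; exists s.
pose x n := iter n (fun b => 1 + b + r%:R * s * b) 0.
have bex n : be (x n) = 1 + r%:R * s * n%:R.
  elim: n => [|n IHn]; first by rewrite /= be0 mulr0 addr0.
  rewrite /x /= -/(x n).
  have -> : 1 + x n + r%:R * s * x n = 1 + be 1 * x n by rewrite s1; ring.
  rewrite beM IHn s1 -(natr1 n).
  transitivity (1 + r%:R * s * (n%:R + 1) + (r%:R * r%:R) * (s * s * n%:R)).
    by ring.
  by rewrite z; ring.
have ber b : be (r%:R * b) = 1.
  have [m ->] := Zsq_natP HR b; rewrite -natrM; have := bex (r * m)%N.
  have -> : x (r * m)%N = (r * m)%:R.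
    rewrite /x circ_iter natrM -[RHS]addr0; congr (_ + _).
    apply: (mulIr Zsq_unit2); rewrite Zsq_half mul0r.
    transitivity ((r%:R * r%:R) * (s * m%:R * (r%:R * m%:R - 1))); last by rewrite z mul0r.
    by ring.
  rewrite natrM => ->; transitivity (1 + (r%:R * r%:R) * (s * m%:R)); first by ring.
  by rewrite z; ring.
have bemod b m : be (b + r%:R * m) = be b.
  have [t tE] := be1 b; have := beM b (r%:R * m); rewrite ber mulr1 => <-.
  congr be; rewrite tE; transitivity (b + r%:R * m + (r%:R * r%:R) * (t * m)).
    by rewrite z mul0r addr0.
  by ring.
move=> b; have [n [xn nE]] := circ_surj s b.
have := bex n; rewrite /x xn nE => ->.
rewrite mulrBr.
rewrite (_ : r%:R * s * (_ / _) = (r%:R * r%:R) * (s * s * b * (b - 1) / 2%:R)).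
  by rewrite z mul0r subr0.
by move: (2%:R^-1) => h; ring.
Qed.

End LocalRing.

(** * Finite cancellative monoids and periodic orbits *)

Section FiniteMonoid.

Variables (T : finType) (op : T -> T -> T) (e : T).
Hypotheses (opA : associative op) (op0 : left_id e op) (op1 : right_id e op).
Hypothesis opI : forall x, injective (op x).

(** Lagrange's theorem for Cayley's embedding: the left translations form a group of [#|T|]
    permutations. *)
Lemma iter_op_card x : iter #|T| (op x) e = e.
Proof.
pose P y : {perm T} := perm (@opI y).
have PE y z : P y z = op y z by rewrite permE.
have P_inj : injective P.
  by move=> y z yz; rewrite -[y]op1 -[z]op1 -!PE yz.
pose G := [set P y | y in T].
have G_group : group_set G.
  apply/group_setP; split=> [|_ _ /imsetP[y _ ->] /imsetP[z _ ->]].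
    by apply/imsetP; exists e => //; apply/permP => z; rewrite PE op0 perm1.
  (* Permutations compose from left to right, hence the reversed product. *)
  apply/imsetP; exists (op z y) => //; apply/permP => t.
  by rewrite permM !PE opA.
have /(expg_cardG (G := Group G_group)) : P x \in G by apply/imsetP; exists x.
rewrite /= card_imset // => /permP/(_ e); rewrite permX perm1.
by under eq_iter => y do rewrite PE.
Qed.

(** An injective left translation of a finite set is onto, which gives right inverses; left
    cancellation makes them two-sided. *)
Lemma cancel_is_group : is_group op.
Proof.
exists e, (fun x => invF (@opI x) e).
have rinv : right_inverse e (fun x => invF (@opI x) e) op.
  by move=> x; exact: (f_invF (@opI x) e).
split=> // x; apply: (@opI x).
by rewrite opA rinv op0 op1.
Qed.

End FiniteMonoid.

(* The average of an orbit whose length is invertible is a fixed point. *)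
Lemma affine_fixpoint (R : comUnitRingType) (m c : R) n :
  n%:R \is a @GRing.unit R -> iter n (fun x => m * x + c) 0 = 0 ->
  exists z, m * z + c = z.
Proof.
move=> n_unit fn0; pose f := fun x => m * x + c.
exists ((\sum_(i < n) iter i f 0) / n%:R); apply: (mulIr n_unit).
rewrite mulrDl mulrA !(divrK n_unit) mulr_sumr.
have -> : c * n%:R = \sum_(i < n) c by rewrite sumr_const card_ord mulr_natr.
rewrite -big_split /=.
have -> : \sum_(i < n) (m * iter i f 0 + c) = \sum_(i < n) iter i.+1 f 0 by [].
case: n fn0 {n_unit} => [|n] fn0; first by rewrite !big_ord0.
rewrite big_ord_recr [RHS]big_ord_recl.
by rewrite addrC; congr (_ + _); exact: fn0.
Qed.

(** * The semidirect product and its automorphisms *)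

Section SemidirectProduct.

Variables (p q : nat) (R Z : finComUnitRingType).
Hypotheses (HR : Zsq q R) (HZ : Zsq p Z) (p_odd : odd p) (q_odd : odd q).
Hypothesis neq_pq : p != q.

Let p_prime := Zsq_prime HZ.
Let q_prime := Zsq_prime HR.

Lemma q_ndvd_p2 : ~~ (q %| p ^ 2)%N.
Proof. by rewrite Euclid_dvdX // dvdn_prime2 // eq_sym (negPf neq_pq). Qed.

Lemma p_ndvd_q2 : ~~ (p %| q ^ 2)%N.
Proof. by rewrite Euclid_dvdX // dvdn_prime2 // (negPf neq_pq). Qed.

Variable E : Z -> R.
Hypotheses (E0 : E 0 = 1) (ED : forall b b', E (b + b') = E b * E b').
Hypothesis E1 : 1 - E 1 \is a GRing.unit.

Lemma E_unit b : E b \is a GRing.unit.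
Proof. by apply/unitrPr; exists (E (- b)); rewrite -ED subrr. Qed.

Lemma E_mulV b : E (- b) * E b = 1.
Proof. by rewrite -ED addNr. Qed.

Lemma E_nat n b : E (n%:R * b) = E b ^+ n.
Proof. by elim: n => [|n IHn]; rewrite ?mul0r // -natr1 mulrDl mul1r ED IHn exprSr. Qed.

(** The condition [E be = E 1] says that multiplication by [be] is compatible with the twisting;
    testing it on the generator 1 suffices. *)
Lemma E_mul1 be b : E be = E 1 -> E (be * b) = E b.
Proof.
move=> Ebe; have [n ->] := Zsq_natP HZ b.
by rewrite mulrC E_nat Ebe -E_nat mulr1.
Qed.

(** If [be - 1] were a unit, [E] would be trivial at a unit, hence at 1, against the invertibility
    of [1 - E 1]. *)
Lemma E_fix be : E be = E 1 -> exists s, be = 1 + p%:R * s.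
Proof.
move=> Ebe; have : be - 1 \isn't a GRing.unit.
  apply/negP => u; have : E (be - 1) = 1.
    by rewrite ED Ebe -ED subrr.
  have [n nE] := Zsq_natP HZ (be - 1)^-1; move/(congr1 (fun x => x ^+ n)).
  rewrite -E_nat -nE mulVr // expr1n => E11.
  by move: E1; rewrite E11 subrr unitr0.
by move=> /(Zsq_unitP HZ)[s sE]; exists s; rewrite -sE addrC subrK.
Qed.

Definition tadd (x y : R * Z) : R * Z := (x.1 + E x.2 * y.1, x.2 + y.2).
Definition topp (x : R * Z) : R * Z := (- (E (- x.2) * x.1), - x.2).

Lemma tadd_group : group_axioms tadd (0, 0) topp.
Proof.
rewrite /tadd /topp; split=> [[a b] [a' b'] [a2 b2]|[a b]|[a b]|[a b]|[a b]] /=;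
  congr pair; rewrite ?E0 ?ED ?add0r ?addr0 ?mulr0 ?addr0 ?mul1r ?addrA ?addNr ?subrr //.
- by ring.
- by rewrite mulrN mulrA (mulrC (E b)) E_mulV mul1r subrr.
Qed.

(** The second coordinate of [f (a, 0)] is additive in [a] and killed by [q ^ 2], a unit of [Z]; so
    [f] preserves [R x 0] and is linear there. The action of [(0, 1)] on [R x 0] forces
    [E be = E 1]. The first coordinate of [f (0, b)] is a cocycle, and a coboundary because
    [1 - E 1] is a unit. *)
Lemma tadd_aut_affine (f : R * Z -> R * Z) :
  injective f -> {morph f : x y / tadd x y} ->
  exists al c be, [/\ al \is a GRing.unit, E be = E 1 &
    forall a b, f (a, b) = (al * a + c * (1 - E b), be * b)].
Proof.
move=> f_inj fM.
have f0 : f (0, 0) = (0, 0).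
  have := fM (0, 0) (0, 0); rewrite {1 2}/tadd /= E0 mul1r !addr0.
  case: (f _) => x y [xE yE]; have y0 : y = 0 by apply: (addrI y); rewrite -yE addr0.
  congr pair => //; apply: (mulrI (E_unit y)); apply: (addrI x).
  by rewrite -xE mulr0 addr0.
have fD a a' : f (a + a', 0) = tadd (f (a, 0)) (f (a', 0)).
  by rewrite -fM /tadd /= E0 mul1r addr0.
have f2 a : (f (a, 0)).2 = 0.
  have H n : (f (n%:R, 0)).2 = n%:R * (f (1, 0)).2.
    elim: n => [|n IHn]; first by rewrite f0 mul0r.
    by rewrite -natr1 fD /= IHn -natr1 mulrDl mul1r.
  have q2 : (q ^ 2)%:R = 0 :> R by apply/eqP; rewrite (Zsq_nat_eq0 HR).
  have h0 : (f (1, 0)).2 = 0.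
    have := H (q ^ 2)%N; rewrite q2 f0 /= => /esym h.
    apply: (mulrI (_ : (q ^ 2)%:R \is a GRing.unit)); last by rewrite h mulr0.
    by rewrite (Zsq_unit_nat HZ) p_ndvd_q2.
  by have [n ->] := Zsq_natP HR a; rewrite H h0 mulr0.
pose al := (f (1, 0)).1.
have f1 a : f (a, 0) = (al * a, 0).
  have [n ->] := Zsq_natP HR a; elim: n => [|n IHn]; first by rewrite f0 mulr0.
  rewrite -natr1 fD IHn /tadd /= f2 E0 mul1r addr0 -/al; congr pair; ring.
have al_unit : al \is a GRing.unit.
  have /fintype.injF_bij[g _ gK] : injective (fun a => al * a).
    by move=> a a' /= aa'; have := f_inj (a, 0) (a', 0); rewrite !f1 aa' => /(_ erefl)[].
  by apply/unitrPr; exists (g 1); rewrite (gK 1).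
case f01: (f (0, 1)) => [c' be].
have Ebe : E be = E 1.
  have := fM (0, 1) (1, 0); have := fM (E 1, 0) (0, 1).
  rewrite /tadd /= !f1 f01 /= E0 !(mul1r, mulr1, add0r, addr0) => -> [].
  by rewrite addrC => /addrI; rewrite mulrC => /(mulIr al_unit).
exists al, (c' / (1 - E 1)), be; split=> // a b.
have fb : f (0, b) = (c' / (1 - E 1) * (1 - E b), be * b).
  have [n ->] := Zsq_natP HZ b; elim: n => [|n IHn].
    by rewrite f0 E0 subrr !mulr0.
  have -> : (0, n.+1%:R) = tadd (0, n%:R) (0, 1) :> R * Z.
    by rewrite /tadd /= mulr0 addr0 natr1.
  rewrite fM IHn f01 /tadd /= E_mul1 // -natr1 ED; congr pair; last by ring.
  by rewrite -{2}[c'](divrK E1); ring.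
have -> : (a, b) = tadd (a, 0) (0, b) by rewrite /tadd /= E0 mul1r addr0 add0r.
by rewrite fM f1 fb /tadd /= E0 mul1r add0r.
Qed.

(** * Skew braces as affine actions, and a common complement *)

(* The action [y |-> x^-1 . (x o y)] of [x] is
   [(a, b) |-> (al x * a + c x * (1 - E b), be x * b)]. *)
Record affine_brace (mul : R * Z -> R * Z -> R * Z) (al c : R * Z -> R)
    (be : R * Z -> Z) : Prop := {
  abE : forall x y, mul x y =
    (x.1 + E x.2 * (al x * y.1 + c x * (1 - E y.2)), x.2 + be x * y.2);
  ab_unit : forall x, al x \is a GRing.unit;
  ab_fix : forall x, E (be x) = E 1;
  ab_alM : forall x y, al (mul x y) = al x * al y;
  ab_cM : forall x y, c (mul x y) = al x * c y + c x;
  ab_beM : forall x y, be (mul x y) = be x * be y;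
  ab_al0 : al (0, 0) = 1;
  ab_c0 : c (0, 0) = 0;
  ab_be0 : be (0, 0) = 1;
  ab_mulA : associative mul }.

(** The maps [phi x] are additive automorphisms and [phi] turns [mul] into composition. Their
    coordinates are read off at [(1, 0)] and [(0, 1)], and composing affine maps gives the rules for
    products. *)
Lemma brace_affine mul : is_skew_brace tadd mul ->
  exists al c be, affine_brace mul al c be.
Proof.
move=> [[e [inv [mA m0 m1 mV mW]]] [e' [inv' [[aA a0 a1 aV aW] mulD]]]].
have e'E : e' = (0, 0).
  by have [_ b0 _ _ _] := tadd_group; rewrite -[LHS]b0 a1.
have [tA t0 t1 tV tW] := tadd_group.
have inv'E x : inv' x = topp x.
  by rewrite -[LHS]a1 e'E -(tW x) tA aV a0.
(* The two identities coincide: the brace relation with [y = z = (0, 0)] makes [(0, 0)] a right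
   identity of [mul]. *)
have eE : e = (0, 0).
  have H x : mul x (0, 0) = x.
    have := mulD x (0, 0) (0, 0); rewrite t0.
    set u := mul x _; rewrite -tA => h.
    have {h} : tadd (topp u) u = tadd (topp u) (tadd u (tadd (inv' x) u)) by rewrite -h.
    rewrite tA tV t0 inv'E => /(congr1 (tadd x)).
    by rewrite tA tW t0 t1.
  by rewrite -(m0 (0, 0)) H.
pose phi x y := tadd (topp x) (mul x y).
have mulE x y : mul x y = tadd x (phi x y) by rewrite /phi tA tW t0.
have phiD x : {morph phi x : y z / tadd y z}.
  by move=> y z; rewrite /phi mulD inv'E !tA.
have mI x : injective (mul x).
  by move=> y z yz; rewrite -[y]m0 -[z]m0 -(mV x) -!mA yz.
have phiI x : injective (phi x).
  by move=> y z yz; apply: (mI x); rewrite !mulE yz.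
have phiM x y z : phi (mul x y) z = phi x (phi y z).
  by rewrite [LHS]/phi -mA (mulE y z) mulD inv'E -tA tA tV t0.
pose al x := (phi x (1, 0)).1.
pose c x := (phi x (0, 1)).1 / (1 - E 1).
pose be x := (phi x (0, 1)).2.
have spec x : [/\ al x \is a GRing.unit, E (be x) = E 1 &
    forall a b, phi x (a, b) = (al x * a + c x * (1 - E b), be x * b)].
  have [al' [c' [be' [al'_unit be'_fix H]]]] := tadd_aut_affine (@phiI x) (phiD x).
  have alE : al x = al' by rewrite /al H /= E0; ring.
  have cE : c x = c' by rewrite /c H /= mulr0 add0r mulrK.
  have beE : be x = be' by rewrite /be H /= mulr1.
  by rewrite alE cE beE.
have phi0 z : phi (0, 0) z = z by rewrite /phi -eE m0 eE -{1}(t0 (topp _)) tW t0.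
exists al, c, be; split=> //; try by move=> x; case: (spec x).
- move=> x [a b]; rewrite mulE; case: (spec x) => _ _ ->.
  by rewrite /tadd.
- move=> x y; rewrite {1}/al phiM; case: (spec y) => _ _ ->.
  by case: (spec x) => _ _ -> /=; rewrite mulr0 E0; ring.
- move=> x y; rewrite {1}/c phiM; case: (spec y) => _ be_fix ->.
  case: (spec x) => _ _ -> /=; rewrite mulr1 be_fix; apply: (mulIr E1).
  by rewrite divrK //; ring.
- move=> x y; rewrite {1}/be phiM; case: (spec y) => _ be_fix ->.
  by case: (spec x) => _ _ -> /=; rewrite mulr1.
- by rewrite /al phi0.
- by rewrite /c phi0 /= mul0r.
- by rewrite /be phi0.
Qed.

Section AffineBrace.

Variables (mul : R * Z -> R * Z -> R * Z) (al c : R * Z -> R) (be : R * Z -> Z).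
Hypothesis ab : affine_brace mul al c be.

Lemma ab_mul0 : left_id (0, 0) mul.
Proof.
move=> [a b]; rewrite (abE ab) (ab_al0 ab) (ab_c0 ab) (ab_be0 ab) /= E0.
by congr pair; ring.
Qed.

Lemma ab_mul1 : right_id (0, 0) mul.
Proof. by move=> [a b]; rewrite (abE ab) /= E0; congr pair; ring. Qed.

Lemma ab_be_unit x : be x \is a GRing.unit.
Proof. by have [s ->] := E_fix (ab_fix ab x); exact: (Zsq_unit1D HZ). Qed.

Lemma ab_mulI x : injective (mul x).
Proof.
move=> [a b] [a' b']; rewrite !(abE ab) /= => -[].
move=> aa' /addrI/(mulrI (ab_be_unit x)) bb'; rewrite {}bb' in aa' *.
move: aa' => /addrI/(mulrI (E_unit _))/addIr/(mulrI (ab_unit ab x))->.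
by [].
Qed.

Lemma ab_mulN a x : mul x (a, 0) = (x.1 + E x.2 * al x * a, x.2).
Proof. by rewrite (abE ab) /= E0; congr pair; ring. Qed.

Lemma ab_N_iter a n :
  iter n (mul (a, 0)) (0, 0) = (iter n (fun a' => a + al (a, 0) * a') 0, 0).
Proof. by elim: n => //= n ->; rewrite ab_mulN /= E0 mul1r. Qed.

Lemma ab_iter_al x n : al (iter n (mul x) (0, 0)) = al x ^+ n.
Proof. by elim: n => [|n IHn]; rewrite ?(ab_al0 ab) // iterS (ab_alM ab) IHn exprS. Qed.

Lemma ab_iter_be x n : be (iter n (mul x) (0, 0)) = be x ^+ n.
Proof. by elim: n => [|n IHn]; rewrite ?(ab_be0 ab) // iterS (ab_beM ab) IHn exprS. Qed.

(** The values of the cocycle [c] at the powers of [x] form an orbit of an affine map, so an element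
    of finite order yields the periodic orbit asked for by [affine_fixpoint]. *)
Lemma ab_iter_c x n :
  iter n (fun t => al x * t + c x) 0 = c (iter n (mul x) (0, 0)).
Proof. by elim: n => [|n IHn]; rewrite ?(ab_c0 ab) // !iterS (ab_cM ab) IHn. Qed.

Lemma ab_N_period a : iter (q ^ 2) (mul (a, 0)) (0, 0) = (0, 0).
Proof.
rewrite ab_N_iter -(Zsq_card HR); congr pair.
pose op a a' := a + al (a, 0) * a'.
have mulN b b' : mul (b, 0) (b', 0) = (op b b', 0).
  by rewrite ab_mulN /= E0 mul1r.
apply: (@iter_op_card _ op) => [b b' b2|b|b|b b' b2].
- by have := ab_mulA ab (b, 0) (b', 0) (b2, 0); rewrite !mulN => -[].
- by rewrite /op (ab_al0 ab) mul1r add0r.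
- by rewrite /op mulr0 addr0.
- by move=> /addrI/(mulrI (ab_unit ab _)).
Qed.

(** The value lies in [1 + p Z] and its [q ^ 2]-th power is 1, while [q] is prime to [p]. *)
Lemma ab_be_N a : be (a, 0) = 1.
Proof.
have [s sE] := E_fix (ab_fix ab (a, 0)).
have := ab_iter_be (a, 0) (q ^ 2); rewrite ab_N_period (ab_be0 ab) sE (Zsq_exp1D HZ).
rewrite -{1}[1]addr0 => /addrI /esym h; suff -> : p%:R * s = 0 by rewrite addr0.
apply: (mulrI (_ : (q ^ 2)%:R \is a GRing.unit)); last by rewrite h mulr0.
by rewrite (Zsq_unit_nat HZ) p_ndvd_q2.
Qed.

(** The period of [(a, 0)] divides [q ^ 2], so its multiplier lies in [1 + q R] and
    [brace_multiplier] applies. *)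
Lemma ab_al_N : exists k, forall a, al (a, 0) = 1 + q%:R * k * a.
Proof.
apply: (brace_multiplier HR q_odd (be := fun a => al (a, 0))) => [a|a a'].
  by apply: (Zsq_pow_r2 HR); rewrite -ab_iter_al ab_N_period (ab_al0 ab).
by rewrite -(ab_alM ab) ab_mulN /= E0 mul1r.
Qed.

Lemma ab_be_snd a b : be (a, b) = be (0, b).
Proof.
have -> : (a, b) = mul (0, b) ((E b * al (0, b))^-1 * a, 0).
  by rewrite ab_mulN /= add0r mulVKr // unitrM E_unit (ab_unit ab).
by rewrite (ab_beM ab) ab_be_N mulr1.
Qed.

Lemma ab_beE : exists k, forall x, be x = 1 + p%:R * k * x.2.
Proof.
have [k kE] : exists k, forall b, be (0, b) = 1 + p%:R * k * b.
  apply: (brace_multiplier HZ p_odd (be := fun b => be (0, b))) => [b|b b'].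
    exact: E_fix (ab_fix ab _).
  by rewrite -(ab_beM ab) (abE ab) /= [RHS]ab_be_snd.
by exists k => -[a b]; rewrite ab_be_snd kE.
Qed.

(** Induction along the powers of [(1, 0)], which generates [R x 0] for [mul]; the cocycle rule
    matches the correction [q k a] in the product. *)
Lemma ab_c_N a : c (a, 0) = c (1, 0) * a.
Proof.
have [k kE] := ab_al_N.
move: a; apply: (circ_ind HR q_odd (k := k)) => [|a IHa]; first by rewrite (ab_c0 ab) mulr0.
have -> : (1 + a + q%:R * k * a, 0) = mul (1, 0) (a, 0).
  by rewrite ab_mulN kE /= E0; congr pair; ring.
by rewrite (ab_cM ab) IHa kE; ring.
Qed.

Lemma ab_iterM x m n :
  iter (m * n) (mul x) (0, 0) = iter m (mul (iter n (mul x) (0, 0))) (0, 0).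
Proof.
have H j y : iter j (mul x) y = mul (iter j (mul x) (0, 0)) y.
  elim: j => [|j IHj]; first by rewrite ab_mul0.
  by rewrite !iterS IHj (ab_mulA ab).
by elim: m => // m IHm; rewrite mulSn iterD H IHm.
Qed.

(** Such a [g] generates a Sylow [p]-subgroup of the multiplicative group. *)
Lemma ab_complement_element : exists2 g : R * Z,
  g.2 = 1 & iter (p ^ 2) (mul g) (0, 0) = (0, 0).
Proof.
have cop : coprime (q ^ 2) (p ^ 2).
  by rewrite coprime_pexpl // coprime_pexpr // prime_coprime // dvdn_prime2 // eq_sym.
(* The exponent is 0 modulo [q ^ 2], so that the power is killed by [p ^ 2], and 1 modulo [p ^ 2],
   so that the second coordinate of [(0, 1)] is kept. *)
pose N := chinese (q ^ 2) (p ^ 2) 0 1.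
have [k kE] := ab_beE.
have N1 : N%:R = 1 :> Z.
  by rewrite -(Zsq_mod_nat HZ) (chinese_modr cop) (Zsq_mod_nat HZ).
exists (iter N (mul (0, 1)) (0, 0)).
  have H n : (iter n (mul (0, 1)) (0, 0)).2 = iter n (fun b => 1 + b + p%:R * k * b) 0.
    by elim: n => // n IHn; rewrite !iterS (abE ab) /= IHn kE /=; ring.
  by rewrite H (circ_iter HZ p_odd) N1 subrr mulr0 mul0r addr0.
rewrite -ab_iterM.
have /dvdnP[m mE] : (q ^ 2 %| N)%N by rewrite /dvdn (chinese_modl cop) mod0n.
rewrite mE mulnA (mulnC (p ^ 2)%N) -mulnA (mulnC (p ^ 2)%N)
  -(Zsq_card HR) -(Zsq_card HZ) -card_prod.
rewrite ab_iterM.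
rewrite (iter_op_card (ab_mulA ab) ab_mul0 ab_mul1 ab_mulI).
by elim: m {mE} => //= m ->; rewrite ab_mul0.
Qed.

(* A complement of the normal subgroup [R x 0] common to both group laws: it is
   the additive one through [(s * (1 - E 1), 1)]. *)
Lemma ab_common_complement :
  exists s, let h := (s * (1 - E 1), 1) in al h * s + c h = s.
Proof.
have [g g2 g_ord] := ab_complement_element.
have p2_unit : (p ^ 2)%:R \is a @GRing.unit R.
  by rewrite (Zsq_unit_nat HR) q_ndvd_p2.
(* First fixed point: the action of [g] preserves the additive complement of the points
   [(z * (1 - E b), b)]. *)
have [z zE] : exists z, al g * z + c g = z.
  by apply: (affine_fixpoint p2_unit); rewrite ab_iter_c g_ord (ab_c0 ab).
(* [pr] is the coordinate along [R x 0] relative to this complement; left multiplication by [g] acts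
   on it through [f]. *)
pose f t := E 1 * al g * t + (g.1 + (E 1 - 1) * z).
pose pr (v : R * Z) := v.1 - z * (1 - E v.2).
have prE v : pr (mul g v) = f (pr v).
  rewrite /pr /f (abE ab) /= g2 ED (E_mul1 _ (ab_fix ab g)).
  have -> : c g = z - al g * z by rewrite -{1}zE; ring.
  by ring.
(* Second fixed point: the translate [pr v = y] of the complement is stable under left
   multiplication by [g]. *)
have [y yE] : exists y, f y = y.
  apply: (affine_fixpoint p2_unit); rewrite -/f.
  have -> n : iter n f 0 = pr (iter n (mul g) (0, 0)).
    elim: n => [|n IHn]; first by rewrite /pr /= E0; ring.
    by rewrite !iterS prE IHn.
  by rewrite g_ord /pr /= E0; ring.
have aly := ab_unit ab (y, 0).
(* Chosen so that the action of [(y, 0)] carries the complement of parameter [s] to that of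
   parameter [z]. *)
pose s := (al (y, 0))^-1 * (z - c (y, 0)).
exists s => h.
have sE : al (y, 0) * s = z - c (y, 0) by rewrite /s mulVKr.
(* Thus [h] is the conjugate of [g] by [(y, 0)] for [mul]; applying [al] and [c] to this identity
   gives the claim. *)
have gy : mul g (y, 0) = mul (y, 0) h.
  rewrite ab_mulN (abE ab) /= g2 ab_be_N E0; congr pair; last by ring.
  rewrite -{2}yE /f mulrA sE; ring.
have alE : al h = al g.
  apply: (mulrI aly); have := congr1 al gy; rewrite !(ab_alM ab) => <-.
  by rewrite mulrC.
have := congr1 c gy; rewrite !(ab_cM ab) => cE.
apply: (mulrI aly); rewrite sE mulrDr (_ : al _ * c h = al g * c (y, 0) + c g - c (y, 0)).
  by rewrite alE mulrCA sE -[in RHS]zE; ring.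
by rewrite cE addrK.
Qed.

End AffineBrace.

(** * Reduction to explicit laws *)

Definition shear s (x : R * Z) : R * Z := (x.1 - s * (1 - E x.2), x.2).

Lemma shearK s : cancel (shear s) (shear (- s)).
Proof. by move=> [a b]; rewrite /shear /=; congr pair; ring. Qed.

Lemma shearVK s : cancel (shear (- s)) (shear s).
Proof. by move=> [a b]; rewrite /shear /=; congr pair; ring. Qed.

Lemma shear_morph s : {morph shear s : x y / tadd x y}.
Proof.
by move=> [a b] [a' b']; rewrite /shear /tadd /= ED; congr pair; ring.
Qed.

(** The shear is conjugation by [(- s, 0)] in the additive group. It changes the cocycle [c] by the
    coboundary [al * s - s], so a fixed point [s] of the affine action of [x] becomes a zero of the
    new cocycle. *)
Lemma affine_brace_shear mul al c be s : affine_brace mul al c be ->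
  affine_brace (fun x y => shear s (mul (shear (- s) x) (shear (- s) y)))
    (fun x => al (shear (- s) x))
    (fun x => al (shear (- s) x) * s + c (shear (- s) x) - s)
    (fun x => be (shear (- s) x)).
Proof.
move=> ab; have s0 : shear (- s) (0, 0) = (0, 0).
  by rewrite /shear /= E0; congr pair; ring.
split=> [x y|x|x|x y|x y|x y||||x y z].
- rewrite (abE ab) /shear /=; congr pair.
  by rewrite ED (E_mul1 _ (ab_fix ab _)); ring.
- exact: ab_unit ab _.
- exact: ab_fix ab _.
- by rewrite shearK (ab_alM ab).
- by rewrite shearK (ab_alM ab) (ab_cM ab); ring.
- by rewrite shearK (ab_beM ab).
- by rewrite s0 (ab_al0 ab).
- by rewrite s0 (ab_al0 ab) (ab_c0 ab); ring.
- by rewrite s0 (ab_be0 ab).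
- by rewrite !shearK (ab_mulA ab).
Qed.

Definition eps (e : bool) (b : Z) : R := if e then E b else 1.

Definition law (e : bool) (t : Z -> R) (J : R) (k : Z) (x y : R * Z) : R * Z :=
  (eps e y.2 * x.1 + t x.2 * y.1 + J * x.1 * y.1,
   x.2 + y.2 + p%:R * k * x.2 * y.2).

(** By [ld_k], [E] is also a character of [b + b' + p k b b'], like [t]. The condition [ld_Jt] comes
    from associativity; written as a product, it leaves [t] free when [J = 0]. *)
Record law_data (e : bool) (t : Z -> R) (J : R) (k : Z) : Prop := {
  ld_k : E (p%:R * k) = 1;
  ld_t0 : t 0 = 1;
  ld_tM : forall b b', t (b + b' + p%:R * k * b * b') = t b * t b';
  ld_J : exists j, J = q%:R * j;
  ld_Jt : forall b, J * t b = J * eps e b }.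

Lemma affine_brace_law mul al c be : affine_brace mul al c be -> c (0, 1) = 0 ->
  exists e t J k, law_data e t J k /\ mul =2 law e t J k.
Proof.
move=> ab c01.
have [j jE] := ab_al_N ab; have [k kE] := ab_beE ab.
set J := q%:R * j in jE.
have mul0 b b' : mul (0, b) (0, b') = (E b * c (0, b) * (1 - E b'), b + b' + p%:R * k * b * b').
  by rewrite (abE ab) /= kE /=; congr pair; ring.
have c0 b : c (0, b) = 0.
  move: b; apply: (circ_ind HZ p_odd (k := k)) => [|b IHb]; first exact: ab_c0 ab.
  have -> : (0, 1 + b + p%:R * k * b) = mul (0, 1) (0, b).
    by rewrite mul0 c01; congr pair; ring.
  by rewrite (ab_cM ab) IHb c01; ring.
pose A b := al (0, b); pose t b := E b * A b.
have Ek : E (p%:R * k) = 1.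
  have := ab_fix ab (0, 1); rewrite kE ED /= mulr1 -[RHS]mulr1.
  by apply: (mulrI (E_unit 1)).
have tM b b' : t (b + b' + p%:R * k * b * b') = t b * t b'.
  have -> : t b * t b' = E b * E b' * (A b * A b') by rewrite /t; ring.
  rewrite /t; congr (_ * _).
    have [n nE] := Zsq_natP HZ (b * b').
    have -> : b + b' + p%:R * k * b * b' = b + b' + n%:R * (p%:R * k).
      by rewrite -nE; ring.
    by rewrite !ED E_nat Ek expr1n mulr1.
  by rewrite /A -(ab_alM ab) mul0 c0 mulr0 mul0r.
have t0 : t 0 = 1 by rewrite /t E0 mul1r; exact: ab_al0 ab.
pose gam := c (1, 0).
have cN a : c (a, 0) = gam * a by exact: ab_c_N ab a.
have nN a b : mul (a, 0) (0, b) = (a * (1 + gam * (1 - E b)), b).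
  by rewrite (abE ab) /= E0 cN kE /=; congr pair; ring.
have Nn a b : mul (0, b) (a, 0) = (t b * a, b).
  by rewrite (ab_mulN ab) /= add0r.
have t_unit b : t b \is a GRing.unit by rewrite unitrM E_unit (ab_unit ab).
(* Apply [c] to two factorisations of one element, with the factor from the complement on the left
   and on the right, and divide by [1 - E 1]. *)
have gam01 : gam * (1 + gam) = 0.
  have H : mul (0, 1) ((t 1)^-1 * (1 + gam * (1 - E 1)), 0) = mul (1, 0) (0, 1).
    by rewrite Nn nN mulVKr // mul1r.
  have := congr1 c H; rewrite !(ab_cM ab) !cN c01 mulr0 add0r mulr1 addr0.
  rewrite -/(A 1) /t => /(congr1 (fun x => E 1 * x)).
  set w := _^-1; have wE : E 1 * A 1 * w = 1 by exact: divrr (t_unit 1).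
  move=> h; apply: (mulrI E1); rewrite mulr0.
  transitivity (gam * (E 1 * A 1 * w) * (1 + gam * (1 - E 1)) - E 1 * gam).
    by rewrite wE; ring.
  by rewrite -h; ring.
(* Applying [al], whose values commute, to a relation moving [(0, b)] past [(1, 0)] shows that the
   element of [R x 0] keeps its multiplier. *)
have JA x y : (forall b, mul (0, b) (1, 0) = mul (x b, 0) (y b)) -> (forall b, y b = (0, b)) ->
    forall b, J * x b = J.
  move=> H yE b; have := congr1 al (H b); rewrite yE !(ab_alM ab) !jE mulrC.
  by move=> /(mulIr (ab_unit ab _))/addrI; rewrite mulr1.
(* In a local ring one of [gam] and [1 + gam] is a unit. *)
have [gam0|gam1] : gam = 0 \/ gam = -1.
  have [gu|/(Zsq_unitP HR)[s sE]] := boolP (gam \is a GRing.unit).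
    right; apply/eqP; rewrite -subr_eq0 opprK addrC; apply/eqP.
    by apply: (mulrI gu); rewrite gam01 mulr0.
  left; apply: (mulIr (_ : 1 + gam \is a GRing.unit)); last by rewrite gam01 mul0r.
  by rewrite sE (Zsq_unit1D HR).
- have Jt : forall b, J * t b = J.
    apply: (JA t (fun b => (0, b))) => // b.
    by rewrite Nn nN gam0; congr pair; ring.
  exists false, t, J, k; split; first split=> //; first by exists j.
    by move=> b; rewrite Jt mulr1.
  move=> [a b] [a' b'].
  have xE : (a, b) = mul (a, 0) (0, b) by rewrite nN gam0; congr pair; ring.
  have alE : al (a, b) = (1 + J * a) * A b by rewrite xE (ab_alM ab) jE.
  have cE : c (a, b) = 0 by rewrite xE (ab_cM ab) c0 cN gam0; ring.
  rewrite (abE ab) kE alE cE /law /= ; congr pair; last by ring.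
  transitivity (a + t b * a' + (J * t b) * a * a'); first by rewrite /t; ring.
  by rewrite Jt; ring.
- have JAb : forall b, J * A b = J.
    apply: (JA A (fun b => (0, b))) => // b.
    by rewrite Nn nN gam1 /t; congr pair; ring.
  exists true, t, J, k; split; first split=> //; first by exists j.
    by move=> b; rewrite /t mulrCA JAb mulrC.
  move=> [a b] [a' b'].
  (* For [gam = -1] the product of [(a, 0)] and [(0, b)] has first coordinate [a * E b], which is
     compensated here. *)
  have xE : (a, b) = mul (E (- b) * a, 0) (0, b).
    rewrite nN gam1; congr pair; transitivity (E (- b) * E b * a); last by ring.
    by rewrite E_mulV mul1r.
  have alE : al (a, b) = (1 + J * (E (- b) * a)) * A b by rewrite xE (ab_alM ab) jE.
  have cE : c (a, b) = - (E (- b) * a).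
    by rewrite xE (ab_cM ab) c0 cN gam1; ring.
  rewrite (abE ab) kE alE cE /law /= ; congr pair; last by ring.
  transitivity (a + t b * a' + (E (- b) * E b) * ((J * A b) * a * a' - a * (1 - E b'))).
    by rewrite /t; ring.
  by rewrite E_mulV JAb; ring.
Qed.

Lemma skew_brace_law mul : is_skew_brace tadd mul ->
  exists e t J k, law_data e t J k /\ skew_brace_iso tadd mul tadd (law e t J k).
Proof.
move=> /brace_affine[al [c [be ab]]].
have [s sE] := ab_common_complement ab.
have [|e [t [J [k [ld mulE]]]]] := affine_brace_law (affine_brace_shear s ab).
  have -> : shear (- s) (0, 1) = (s * (1 - E 1), 1).
    by rewrite /shear /=; congr pair; ring.
  by rewrite sE subrr.
exists e, t, J, k; split=> //; exists (shear s); split.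
- exact: Bijective (shearK s) (shearVK s).
- exact: shear_morph.
- by move=> x y; rewrite -mulE !shearK.
Qed.

(** * Characters, isomorphisms and invariants of the laws *)

Lemma eps0 e : eps e 0 = 1.
Proof. by case: e. Qed.

Lemma eps_circ e k b b' : E (p%:R * k) = 1 ->
  eps e (b + b' + p%:R * k * b * b') = eps e b * eps e b'.
Proof.
case: e => Ek; rewrite /eps ?mulr1 //.
have [n nE] := Zsq_natP HZ (b * b').
have -> : b + b' + p%:R * k * b * b' = b + b' + n%:R * (p%:R * k).
  by rewrite -nE; ring.
by rewrite !ED E_nat Ek expr1n mulr1.
Qed.

Lemma p_fix be x : E be = E 1 -> p%:R * (be * x) = p%:R * x.
Proof.
move=> /E_fix[s ->]; transitivity (p%:R * x + (p%:R * p%:R) * (s * x)); first by ring.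
by rewrite (Zsq_char HZ); ring.
Qed.

(** The quadratic term sees [be] only modulo [p], where it is 1. *)
Lemma circ_mul be k b b' : E be = E 1 ->
  be * (b + b' + p%:R * k * b * b') = be * b + be * b' + p%:R * k * (be * b) * (be * b').
Proof.
move=> be_fix; transitivity (be * b + be * b' + p%:R * (be * (k * b * b'))); first by ring.
rewrite (p_fix _ be_fix) -(p_fix (k * b * b') be_fix) -(p_fix _ be_fix).
by ring.
Qed.

Definition circ_char (k : Z) (t : Z -> R) : Prop :=
  t 0 = 1 /\ forall b b', t (b + b' + p%:R * k * b * b') = t b * t b'.

Section CircChar.

Variables (k : Z) (t : Z -> R).
Hypothesis tP : circ_char k t.

Lemma circ_char_iter n :
  t (iter n (fun b => 1 + b + p%:R * k * b) 0) = t 1 ^+ n.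
Proof.
elim: n => [|n IHn]; first by case: tP.
by rewrite iterS exprS -IHn -(proj2 tP); congr t; ring.
Qed.

Lemma circ_char_torsion b : t b ^+ (p ^ 2) = 1.
Proof.
have [n [<- _]] := circ_surj HZ p_odd k b.
rewrite circ_char_iter exprAC -circ_char_iter (circ_iter HZ p_odd).
have -> : (p ^ 2)%:R = 0 :> Z by apply/eqP; rewrite (Zsq_nat_eq0 HZ).
by rewrite mulr0 !mul0r addr0 (proj1 tP) expr1n.
Qed.

Lemma circ_char_unit b : t b \is a GRing.unit.
Proof.
by rewrite -(unitrX_pos _ (_ : 0 < p ^ 2)%N) ?circ_char_torsion ?unitr1 // expn_gt0 prime_gt0.
Qed.

Lemma circ_char_eq t' : circ_char k t' -> t 1 = t' 1 -> t =1 t'.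
Proof.
move=> [t'0 t'M] tt' b; move: b; apply: (circ_ind HZ p_odd (k := k)) => [|b IHb].
  by rewrite t'0 (proj1 tP).
have -> : 1 + b + p%:R * k * b = 1 + b + p%:R * k * 1 * b by ring.
by rewrite (proj2 tP) t'M tt' IHb.
Qed.

Lemma circ_char_mul be : E be = E 1 -> circ_char k (fun b => t (be * b)).
Proof.
move=> be_fix; split=> [|b b']; first by rewrite mulr0 (proj1 tP).
by rewrite circ_mul // (proj2 tP).
Qed.

End CircChar.

Lemma eps_char e k : E (p%:R * k) = 1 -> circ_char k (eps e).
Proof. by move=> Ek; split=> [|b b']; [exact: eps0 | exact: eps_circ]. Qed.

Lemma law_data_char e t J k : law_data e t J k -> circ_char k t.
Proof. by case=> Ek t0 tM _ _; split. Qed.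

(** Associativity and left cancellation give a group by finiteness; the brace relation is the
    additivity of the maps [phi x]. *)
Lemma law_is_brace e t J k : law_data e t J k -> is_skew_brace tadd (law e t J k).
Proof.
move=> ld; have tP := law_data_char ld; have [Ek t0 tM [j jE] Jt] := ld.
have epsM := eps_circ e _ _ Ek.
have lA : associative (law e t J k).
  move=> [a b] [a' b'] [a2 b2]; rewrite /law /=; congr pair; last by ring.
  rewrite epsM tM.
  transitivity (eps e b' * eps e b2 * a + t b * (eps e b2 * a' + t b' * a2 + J * a' * a2)
    + J * a * (eps e b2 * a') + (J * t b') * a * a2 + J * a * (J * a' * a2)).
    by ring.
  by rewrite Jt; ring.
have l0 : left_id (0, 0) (law e t J k).
  by move=> [a b]; rewrite /law /= t0; congr pair; ring.
have l1 : right_id (0, 0) (law e t J k).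
  by move=> [a b]; rewrite /law /= eps0; congr pair; ring.
split.
  apply: (cancel_is_group lA l0 l1) => -[a b] [a' b'] [a2 b2]; rewrite /law /=.
  move=> [aE bE]; have {}bE : b' = b2.
    apply: (mulrI (Zsq_unit1D HZ (k * b))).
    by apply: (addrI b); move: bE; rewrite !mulrDl !mul1r !addrA !mulrA.
  rewrite {}bE in aE *; congr pair.
  (* This is the coefficient of [a'] in the product: a unit plus a multiple of [q]. *)
  have u : t b + J * a \is a GRing.unit.
    have tu := circ_char_unit tP b.
    have -> : t b + J * a = t b * (1 + q%:R * (j * a / t b)).
      rewrite mulrDr mulr1; congr (_ + _).
      by rewrite jE [RHS]mulrC -!mulrA mulVr ?mulr1.
    by rewrite unitrM tu (Zsq_unit1D HR).
  apply: (mulrI u); apply: (addrI (eps e b2 * a)).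
  by move: aE; rewrite !mulrDl !addrA.
exists (0, 0), topp; split; first exact: tadd_group.
have [tA ta0 ta1 tV tW] := tadd_group.
pose phi (x y : R * Z) := (E (- x.2) * ((t x.2 + J * x.1) * y.1 + (eps e y.2 - 1) * x.1),
  (1 + p%:R * k * x.2) * y.2).
have lawE x y : law e t J k x y = tadd x (phi x y).
  case: x y => [a b] [a' b']; rewrite /law /tadd /phi /=; congr pair; last by ring.
  by rewrite mulrA (mulrC (E b)) E_mulV; ring.
have phiD x y z : phi x (tadd y z) = tadd (phi x y) (phi x z).
  case: x y z => [a b] [a' b'] [a2 b2]; rewrite /phi /tadd /=; congr pair; last by ring.
  have -> : E ((1 + p%:R * k * b) * b') = E b'.
    apply: E_mul1; rewrite ED [p%:R * k * b]mulrC; have [n ->] := Zsq_natP HZ b.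
    by rewrite E_nat Ek expr1n mulr1.
  case: (e) (Jt) => {}Jt; rewrite /eps; last first.
    rewrite subrr !mul0r !addr0; transitivity (E (- b) * ((t b + J * a) * a') +
      E (- b) * E b' * ((t b + J * a) * a2)); first by ring.
    by ring.
  by rewrite ED; ring.
by move=> x y z; rewrite !lawE phiD -!tA; congr tadd; rewrite (tA (topp x)) tV ta0.
Qed.

(** The isomorphism is the diagonal map with entries [al] and [be]; the parameter [k] enters only
    through [p k]. *)
Lemma law_iso_scale e t J k t' J' k' al be :
  al \is a GRing.unit -> E be = E 1 -> p%:R * k = p%:R * k' -> J = J' * al ->
  (forall b, t b = t' (be * b)) ->
  skew_brace_iso tadd (law e t J k) tadd (law e t' J' k').
Proof.
move=> al_unit be_fix kk' JJ' tt'.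
have be_unit : be \is a GRing.unit.
  by have [s ->] := E_fix be_fix; exact: (Zsq_unit1D HZ).
exists (fun x => (al * x.1, be * x.2)); split.
- exists (fun x => (al^-1 * x.1, be^-1 * x.2)) => -[a b] /=.
    by rewrite !mulKr.
  by rewrite !mulVKr.
- move=> [a b] [a' b']; rewrite /tadd /= (E_mul1 _ be_fix); congr pair; ring.
- move=> [a b] [a' b']; rewrite /law /= kk' circ_mul // tt' JJ'.
  congr pair; rewrite (_ : eps e (be * b') = eps e b'); first by ring.
  by case: e => //; exact: E_mul1.
Qed.

(** An isomorphism is affine by [tadd_aut_affine], and each invariant is read off from one product
    of elements supported on a single coordinate. *)
Lemma law_iso_invariants e t J k e' t' J' k' :
  law_data e t J k -> law_data e' t' J' k' ->
  skew_brace_iso tadd (law e t J k) tadd (law e' t' J' k') ->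
  [/\ e = e', p%:R * k = p%:R * k', (J == 0) = (J' == 0) &
    exists2 be, E be = E 1 & forall b, t b = t' (be * b)].
Proof.
move=> ld ld' [f [f_bij fD fM]].
have tP := law_data_char ld; have tP' := law_data_char ld'.
have [Ek t0 tM [j jE] Jt] := ld; have [Ek' t'0 t'M [j' j'E] Jt'] := ld'.
have [al [c [be [al_unit be_fix fE]]]] := tadd_aut_affine (bij_inj f_bij) fD.
have be_unit : be \is a GRing.unit.
  by have [s ->] := E_fix be_fix; exact: (Zsq_unit1D HZ).
have fM' a b a' b' := fM (a, b) (a', b').
have epsE b : eps e b = eps e' b + q%:R * (j' * (c * (1 - E b))).
  have := fM' 1 0 0 b; rewrite /law /= !fE /= => -[h _].
  apply: (mulrI al_unit); apply: (addIr (c * (1 - E b))).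
  move: h; rewrite ?(mulr0, t0, t'0, mul0r, addr0, mulr1, add0r, E0, subrr).
  move=> ->; rewrite j'E (_ : eps e' (be * b) = eps e' b); first by ring.
  by case: (e') => //; exact: E_mul1.
(* The candidates 1 and [E 1] for the coefficient at [b = 1] differ by a unit, hence not by a
   multiple of [q]. *)
have ee' : e = e'.
  have := epsE 1; set x := _ * (1 - E 1); move: E1; rewrite /eps.
  have nu : q%:R * (j' * x) \isn't a @GRing.unit R by apply/(Zsq_unitP HR); eexists.
  case: (e) (e') => [] [] // u h; case/negP: nu.
    have -> : q%:R * (j' * x) = - (1 - E 1) by rewrite h; ring.
    by rewrite unitrN.
  by have -> : q%:R * (j' * x) = 1 - E 1 by apply: (addrI (E 1)); rewrite -h; ring.
split=> //.
- have := fM' 0 1 0 1; rewrite /law /= !fE /= => -[_].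
  rewrite !mulr1 !mulrDr !mulr1 => /addrI h.
  have {}h : be * (p%:R * k) = be * (p%:R * (be * k')) by rewrite h; ring.
  by move/(mulrI be_unit): h; rewrite p_fix.
- have := fM' 1 0 1 0; rewrite /law /= !fE /= => -[h _].
  have {}h : J = J' * al.
    apply: (mulrI al_unit); apply: (addrI (al + al)); move: h.
    rewrite ?(mulr0, eps0, t0, t'0, E0, subrr, addr0, mulr1, mul1r) => h.
    by transitivity (al * (1 + 1 + J)); [ring | rewrite h; ring].
  by rewrite h mulIr_eq0 //; exact: mulIr.
(* The product of [(0, b)] and [(1, 0)] determines [t b] modulo [q], which is enough since both
   values are [p ^ 2]-torsion. *)
- exists be => // b.
  apply: (Zsq_torsion_eq HR q_ndvd_p2); rewrite ?(circ_char_torsion tP) ?(circ_char_torsion tP') //.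
  apply/(Zsq_unitP HR); exists (j' * (c * (1 - E b))).
  have := fM' 0 b 1 0; rewrite /law /= !fE /= => -[h _].
  apply: (mulrI al_unit); apply: (addIr (c * (1 - E b))); move: h.
  rewrite ?(mulr0, mul0r, eps0, E0, subrr, addr0, add0r, mulr1, mul1r) => h.
  by rewrite mulrBr addrAC h j'E; ring.
Qed.

(** A nonzero [J = q j] has [j] a unit, so scaling the first coordinate by [j] turns it into [q].
    Then [q t = q eps] forces [t = eps], both being torsion of order prime to [q]. *)
Lemma skew_brace_normal mul : is_skew_brace tadd mul ->
  exists e (j : bool) t k, let J := if j then q%:R else 0 in
  [/\ law_data e t J k, j -> t =1 eps e & skew_brace_iso tadd mul tadd (law e t J k)].
Proof.
move=> /skew_brace_law[e [t [J [k [ld iso]]]]].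
have [J0|J0] := eqVneq J 0; first by exists e, false, t, k; rewrite /= -J0.
exists e, true, t, k => J'.
have tP := law_data_char ld; have [Ek t0 tM [j jE] Jt] := ld.
have j_unit : j \is a GRing.unit.
  apply: contraNT J0 => /(Zsq_unitP HR)[y yE].
  by rewrite jE yE mulrA (Zsq_char HR) mul0r.
have q0 : q%:R != 0 :> R by apply: contraNneq J0 => q0; rewrite jE q0 mul0r.
have J't b : q%:R * t b = q%:R * eps e b.
  by apply: (mulIr j_unit); rewrite -!mulrA ![_ * j]mulrC !mulrA -jE Jt.
have ld' : law_data e t J' k by split=> //; exists 1; rewrite mulr1.
split=> // [_ b|].
  apply: (Zsq_torsion_eq_mul HR q_ndvd_p2 (circ_char_torsion tP b) _ q0 (J't b)).
  exact: circ_char_torsion (eps_char e Ek) b.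
have [g [g_bij gD gM]] : skew_brace_iso tadd (law e t J k) tadd (law e t J' k).
  by apply: (@law_iso_scale _ _ _ _ _ _ _ j 1) => // b; rewrite mul1r.
have [f [f_bij fD fM]] := iso.
exists (g \o f); split; first exact: bij_comp.
  by move=> x y /=; rewrite fD gD.
by move=> x y /=; rewrite fM gM.
Qed.

End SemidirectProduct.

(** * Roots of unity and power characters *)

Lemma uniq_roots_of_uniq (R : unitRingType) (rs : seq R) : uniq rs ->
  {in rs &, forall x y, x != y -> diff_roots x y} -> uniq_roots rs.
Proof.
elim: rs => //= x rs IHrs /andP[x_rs rs_uniq] rsD; apply/andP; split.
  apply/allP => y y_rs; apply: rsD; rewrite ?mem_head ?in_cons ?y_rs ?orbT //.
  by apply: contraNneq x_rs => ->.
by apply: IHrs => // y z y_rs z_rs; apply: rsD; rewrite in_cons ?y_rs ?z_rs orbT.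
Qed.

(** By [Zsq_torsion_eq], distinct roots of [X^n - 1] have invertible differences, so there are at
    most [n] of them; the powers of [w] already are [n] roots. *)
Lemma Zsq_unit_root (r : nat) (R : finComUnitRingType) (w : {unit R}) (x : R) :
  Zsq r R -> ~~ (r %| #[w]%g)%N -> x ^+ #[w]%g = 1 ->
  exists m, x = val w ^+ m.
Proof.
move=> HR rw xn; set n := #[w]%g in rw xn *.
have n_gt0 : (0 < n)%N := order_gt0 w.
pose rs := [seq val w ^+ i | i <- iota 0 n].
have wn : val w ^+ n = 1 by rewrite -FinRing.val_unitX expg_order.
have [/mapP[m _ ->]|x_rs] := boolP (x \in rs); first by exists m.
have xrs_tors : {in x :: rs, forall y, y ^+ n = 1}.
  move=> y; rewrite in_cons => /predU1P[->//|/mapP[i _ ->]].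
  by rewrite exprAC wn expr1n.
have rs_uniq : uniq rs.
  rewrite map_inj_in_uniq ?iota_uniq // => i j; rewrite !mem_iota !add0n => i_n j_n.
  rewrite -!FinRing.val_unitX => /val_inj/eqP.
  by rewrite eq_expg_mod_order !modn_small // => /eqP.
suff : (size (x :: rs) < size ('X^n - 1%:P : {poly R})%R)%N.
  by rewrite size_XnsubC //= size_map size_iota ltnn.
apply: max_ring_poly_roots; first by rewrite -size_poly_eq0 size_XnsubC.
  apply/allP => y y_in; rewrite rootE !hornerE.
  by rewrite xrs_tors // subrr.
apply: uniq_roots_of_uniq; first by rewrite /= x_rs.
move=> y z y_in z_in yz; rewrite /diff_roots mulrC eqxx /=.
apply: contraNT yz => zy; apply/eqP/esym.
by apply: (Zsq_torsion_eq HR rw) => //; exact: xrs_tors.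
Qed.

Section Character.

Variables (p q : nat) (R Z : finComUnitRingType).
Hypotheses (HR : Zsq q R) (HZ : Zsq p Z) (neq_pq : p != q).
Variables (w : {unit R}) (W : Z -> R).
Hypothesis WE : forall n, W n%:R = val w ^+ n.

Lemma char0 : W 0 = 1.
Proof. by rewrite -[0]/(0%:R) WE. Qed.

Lemma charD b b' : W (b + b') = W b * W b'.
Proof.
have [n ->] := Zsq_natP HZ b; have [m ->] := Zsq_natP HZ b'.
by rewrite -natrD !WE exprD.
Qed.

Lemma char_eq m n : W m%:R = W n%:R <-> m = n %[mod #[w]%g].
Proof.
rewrite !WE -!FinRing.val_unitX; split=> [/val_inj/eqP|/eqP].
  by rewrite eq_expg_mod_order => /eqP.
by rewrite -eq_expg_mod_order => /eqP ->.
Qed.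

(** 1 and [W 1] are distinct torsion elements of order prime to [q], so their difference is a
    unit. *)
Lemma char_unit : ~~ (q %| #[w]%g)%N -> (1 < #[w]%g)%N -> 1 - W 1 \is a GRing.unit.
Proof.
move=> qw w_gt1; rewrite -[W 1]/(W 1%:R); apply/negPn/negP => u.
have : W 0%:R = W 1%:R.
  rewrite !WE expr0; apply: (Zsq_torsion_eq HR qw); rewrite ?expr1n //.
    by rewrite expr1 -FinRing.val_unitX expg_order.
  by rewrite -WE.
by move/char_eq; rewrite mod0n modn_small.
Qed.

Lemma char_surj x : ~~ (q %| #[w]%g)%N -> x ^+ #[w]%g = 1 -> exists m, x = W m.
Proof.
by move=> qw /(Zsq_unit_root HR qw)[m ->]; exists m%:R; rewrite WE.
Qed.

Lemma char_inj : #[w]%g = (p ^ 2)%N -> injective W.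
Proof.
move=> wp b b'; have [n ->] := Zsq_natP HZ b; have [m ->] := Zsq_natP HZ b'.
by move=> /char_eq; rewrite wp -(Zsq_mod_nat HZ) => ->; rewrite (Zsq_mod_nat HZ).
Qed.

Lemma char_pmul b : #[w]%g = p -> W (p%:R * b) = 1.
Proof.
move=> wp; have [n ->] := Zsq_natP HZ b; rewrite -natrM -char0 -[0]/(0%:R).
by apply/char_eq; rewrite wp modnMr mod0n.
Qed.

Lemma char_eq_p b b' : #[w]%g = p -> W b = W b' -> p%:R * b = p%:R * b'.
Proof.
move=> wp; have [n ->] := Zsq_natP HZ b; have [m ->] := Zsq_natP HZ b'.
move=> /char_eq; rewrite wp => nm; rewrite -!natrM -(Zsq_mod_nat HZ) -[in RHS](Zsq_mod_nat HZ).
by rewrite -mulnn -!muln_modr nm.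
Qed.

Lemma Zsq_pmul_inj m n : (m < p)%N -> (n < p)%N ->
  p%:R * m%:R = p%:R * n%:R :> Z -> m = n.
Proof.
move=> mp np; rewrite -!natrM => /(Zsq_nat_eq HZ)/eqP.
by rewrite -mulnn -!muln_modr eqn_pmul2l ?prime_gt0 ?(Zsq_prime HZ) // !modn_small // => /eqP.
Qed.

End Character.

(** * Transport of structure and lists of representatives *)

Lemma uniq_cat_pred (T : eqType) (P : pred T) (s1 s2 : seq T) :
  all P s1 -> all (predC P) s2 -> uniq s1 -> uniq s2 -> uniq (s1 ++ s2).
Proof.
move=> /allP s1P /allP s2P u1 u2; rewrite cat_uniq u1 u2 andbT /=.
by apply/hasPn => x /s2P; apply: contraNN; exact: s1P.
Qed.

Lemma skew_brace_iso_trans (T1 T2 T3 : Type) (add1 mul1 : T1 -> T1 -> T1)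
    (add2 mul2 : T2 -> T2 -> T2) (add3 mul3 : T3 -> T3 -> T3) :
  skew_brace_iso add1 mul1 add2 mul2 -> skew_brace_iso add2 mul2 add3 mul3 ->
  skew_brace_iso add1 mul1 add3 mul3.
Proof.
move=> [f [f_bij fD fM]] [g [g_bij gD gM]]; exists (g \o f); split.
- exact: bij_comp.
- by move=> x y; rewrite /= fD gD.
- by move=> x y; rewrite /= fM gM.
Qed.

Lemma group_axioms_transfer (T1 T2 : Type) (op1 : T1 -> T1 -> T1)
    (op2 : T2 -> T2 -> T2) (f : T1 -> T2) (g : T2 -> T1) e inv :
  cancel f g -> cancel g f -> {morph f : x y / op1 x y >-> op2 x y} ->
  group_axioms op1 e inv -> group_axioms op2 (f e) (fun x => f (inv (g x))).
Proof.
move=> fK gK fM [A L1 R1 LV RV]; split=> [x y z|x|x|x|x].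
- by rewrite -(gK x) -(gK y) -(gK z) -!fM A.
- by rewrite -(gK x) -!fM L1.
- by rewrite -(gK x) -!fM R1.
- by rewrite -{2}(gK x) -!fM LV.
- by rewrite -{1}(gK x) -!fM RV.
Qed.

Lemma skew_brace_transport (S T : Type) (addS mulS : S -> S -> S)
    (add : T -> T -> T) :
  is_skew_brace addS mulS -> group_iso addS add ->
  exists mul, is_skew_brace add mul /\ skew_brace_iso addS mulS add mul.
Proof.
move=> [[e [inv mulG]] [e' [inv' [addG mulD]]]] [f [[g fK gK] fD]].
pose mul x y := f (mulS (g x) (g y)).
have fM : {morph f : x y / mulS x y >-> mul x y} by move=> x y; rewrite /mul !fK.
exists mul; split; last by exists f; split=> //; exists g.
split; first by exists (f e), (fun x => f (inv (g x))); exact: group_axioms_transfer mulG.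
exists (f e'), (fun x => f (inv' (g x))); split; first exact: group_axioms_transfer addG.
by move=> x y z; rewrite -(gK x) -(gK y) -(gK z) -!(fD, fM) mulD !fK !(fD, fM).
Qed.

(** Indexing the laws by parameters turns irredundancy into injectivity on a duplicate-free list;
    transport of structure reduces completeness to braces on [T] with addition [add]. *)
Lemma classifies_map (T : Type) (add : T -> T -> T) (X : eqType)
    (F : X -> T -> T -> T) (s : seq X) N :
  size s = N -> uniq s ->
  {in s, forall x, is_skew_brace add (F x)} ->
  {in s &, forall x y, skew_brace_iso add (F x) add (F y) -> x = y} ->
  (forall mul, is_skew_brace add mul ->
     exists2 x, x \in s & skew_brace_iso add mul add (F x)) ->
  classifies add N (map F s).
Proof.
case: s => [|x0 s'] sN s_uniq s_brace s_inj s_all.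
  rewrite -sN; split=> // [i j /andP[_] //|S addS mulS /skew_brace_transport H].
  by move=> /H[mul [mulB _]]; have [] := s_all mul mulB.
set s := x0 :: s' in sN s_uniq s_brace s_inj s_all *.
have nthE i : (i < N)%N -> nth add (map F s) i = F (nth x0 s i).
  by move=> iN; rewrite (nth_map x0) // sN.
split=> [|i iN|i j /andP[ij jN]|S addS mulS mulB /(skew_brace_transport mulB)].
- by rewrite size_map.
- by rewrite nthE //; apply: s_brace; rewrite mem_nth // sN.
- have iN := ltn_trans ij jN; rewrite !nthE // => /s_inj eq_ij.
  have /eqP : nth x0 s i = nth x0 s j by apply: eq_ij; rewrite mem_nth // sN.
  by rewrite nth_uniq ?sN // ltn_eqF.
- move=> [mul [/s_all[x x_s isox] iso]]; exists (index x s).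
    by rewrite -sN index_mem.
  rewrite nthE -?sN ?index_mem // nth_index //.
  exact: skew_brace_iso_trans iso isox.
Qed.

(* [(e, j, k, d, l)] encodes the law in which the coefficient of [a] is [u^b']
   if [e] and [1] otherwise, the term [q a a'] is present iff [j], the second
   component is [b + b' + k p b b'], and the coefficient of [a'] is the power of
   [v] (if [d]) or of [u] (otherwise) of index [l]. If [j], then [d] and [l] are
   void, and [a] and [a'] have the same kind of coefficient. *)
Definition param : eqType := (bool * bool * nat * bool * nat)%type.

(** * Enumeration of the parameters *)

Section Params.

Variable p : nat.

Definition plain (e d : bool) (ls : seq nat) : seq param :=
  [seq (e, false, 0%N, d, l) | l <- ls].

Definition twist (e d : bool) (ls : seq nat) : seq param :=
  [seq (e, false, k, d, l) | l <- ls, k <- iota 1 p.-1].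

Definition params_u : seq param :=
  plain false false (iota 0 p) ++ twist false false (iota 0 p) ++
  plain true false (iota 0 p) ++ twist true false (iota 0 p) ++
  [seq (false, true, k, false, 0%N) | k <- iota 0 p] ++
  [:: (true, true, 0%N, false, 0%N)] ++
  [seq (true, true, k, false, 0%N) | k <- iota 1 p.-1].

Definition params_v : seq param :=
  plain false true (iota 1 p.-1) ++ twist false true (iota 1 p.-1) ++
  plain true true (iota 1 p.-1) ++ twist true true (iota 1 p.-1).

Definition params (B : bool) : seq param :=
  params_u ++ (if B then params_v else [::]).

(** This describes membership in [params B], where [B] stands for [p ^ 2 %| q - 1]. Powers of [v]
    need [l > 0], as exponent 0 is already listed for [u]. *)
Definition valid (B : bool) (x : param) : bool :=
  let: (e, j, k, d, l) := x in
  [&& (k < p)%N, (l < p)%N, j ==> ~~ d && (l == 0%N) & d ==> B && (0 < l)%N].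

Lemma plain_uniq e d ls : uniq ls -> uniq (plain e d ls).
Proof. by move=> ls_uniq; rewrite map_inj_uniq // => l l' []. Qed.

Lemma twist_uniq e d ls : uniq ls -> uniq (twist e d ls).
Proof.
move=> ls_uniq; apply: allpairs_uniq; rewrite ?iota_uniq //.
by move=> [l k] [l' k'] _ _ [-> ->].
Qed.

Hypothesis p_gt0 : (0 < p)%N.

Lemma mem_iota0 l : (l \in iota 0 p) = (l < p)%N.
Proof. by rewrite mem_iota add0n. Qed.

Lemma mem_iota1 l : (l \in iota 1 p.-1) = (0 < l < p)%N.
Proof. by rewrite mem_iota add1n prednK. Qed.

Lemma mem_plain e d l ls : l \in ls -> ((e, false, 0%N, d, l) : param) \in plain e d ls.
Proof. by move=> l_ls; apply/mapP; exists l. Qed.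

Lemma mem_twist e d k l ls : (0 < k < p)%N -> l \in ls ->
  ((e, false, k, d, l) : param) \in twist e d ls.
Proof. by move=> k_p l_ls; apply/allpairsP; exists (l, k); rewrite mem_iota1. Qed.

Lemma all_plain (P : pred param) e d ls :
  {in ls, forall l, P (e, false, 0%N, d, l)} -> all P (plain e d ls).
Proof. by move=> H; apply/allP => x /mapP[l /H Hl ->]. Qed.

Lemma all_twist (P : pred param) e d ls :
  {in ls, forall l k, (0 < k < p)%N -> P (e, false, k, d, l)} -> all P (twist e d ls).
Proof.
move=> H; apply/allP => x /allpairsP[[l k] [/= /H Hl]].
by rewrite mem_iota1 => /Hl ? ->.
Qed.

Lemma all_braided (P : pred param) e ks :
  {in ks, forall k, P (e, true, k, false, 0%N)} ->
  all P [seq (e, true, k, false, 0%N) | k <- ks].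
Proof. by move=> H; apply/allP => x /mapP[k /H Hk ->]. Qed.

Lemma size_params B :
  size (params B) = (if B then 4 * p ^ 2 else 2 * p ^ 2 + 2 * p)%N.
Proof.
rewrite /params /params_u /params_v /plain /twist.
case: B; rewrite !size_cat ?size_allpairs !size_map ?size_allpairs !size_iota /= -mulnn.
  by case: p p_gt0 => // n _ /=; rewrite !(mulSn, mulnS); ring.
by case: p p_gt0 => // n _ /=; rewrite !(mulSn, mulnS); ring.
Qed.

Lemma params_valid B : {in params B, forall x, valid B x}.
Proof.
apply/allP; rewrite all_cat; apply/andP; split.
  rewrite !all_cat; do ?[apply/andP; split];
    by [apply: all_plain => l; rewrite mem_iota0 => /= ->; rewrite p_gt0
       |apply: all_twist => l; rewrite mem_iota0 => /= -> k /andP[_ ->]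
       |apply: all_braided => k; rewrite mem_iota0 => /= ->; rewrite p_gt0
       |idtac
       |apply: all_braided => k; rewrite mem_iota1 => /= /andP[_ ->]; rewrite p_gt0].
case: B => //; rewrite !all_cat; do ?[apply/andP; split];
  by [apply: all_plain => l; rewrite mem_iota1 => /= /andP[-> ->]; rewrite p_gt0
     |apply: all_twist => l; rewrite mem_iota1 => /= /andP[-> ->] k /andP[_ ->]].
Qed.

Lemma mem_params B x : valid B x -> x \in params B.
Proof.
case: x => -[[[e j] k] d] l /and4P[k_p l_p jP dP]; rewrite mem_cat.
case: j jP => [/andP[/negbTE-> /eqP->]|_].
  apply/orP; left; rewrite !mem_cat; case: e.
    case: k k_p => [|k] k_p; first by rewrite mem_head !orbT.
    by rewrite (map_f (fun k => (true, true, k, false, 0%N) : param)) ?mem_iota1 ?orbT.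
  by rewrite (map_f (fun k => (false, true, k, false, 0%N) : param)) ?mem_iota0 ?orbT.
case: d dP => [/andP[-> l_gt0]|_]; apply/orP; [right|left]; rewrite !mem_cat.
  have l_in : l \in iota 1 p.-1 by rewrite mem_iota1 l_gt0.
  case: k k_p => [|k] k_p; first by case: e; rewrite mem_plain ?orbT.
  by case: e; rewrite mem_twist ?orbT.
have l_in : l \in iota 0 p by rewrite mem_iota0.
case: k k_p => [|k] k_p; first by case: e; rewrite mem_plain ?orbT.
by case: e; rewrite mem_twist ?orbT.
Qed.

Lemma params_uniq B : uniq (params B).
Proof.
have iu a b : uniq (iota a b) by exact: iota_uniq.
(* [code] is constant on each block and tells the blocks with the same [d] apart. Its last bit is
   forced on the block with [e] false and [j] true, where [k = 0] is listed together with the other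
   [k]. *)
pose code (x : param) := let: (e, j, k, d, l) := x in
  (e, j, d, (~~ e && j) || (k == 0%N)).
have braided_uniq (e : bool) ks : uniq ks ->
    uniq [seq (e, true, k, false, 0%N) : param | k <- ks].
  by move=> ks_uniq; rewrite map_inj_uniq // => k k' [].
have step c s1 s2 : all (fun x => code x == c) s1 -> all (fun x => code x != c) s2 ->
    uniq s1 -> uniq s2 -> uniq (s1 ++ s2).
  exact: (@uniq_cat_pred _ (fun x => code x == c)).
have nil_braided c : c.1.1.2 = false ->
    all (fun x => code x != c) ([seq (false, true, k, false, 0%N) : param | k <- iota 0 p] ++
  [:: (true, true, 0%N, false, 0%N)] ++
  [seq (true, true, k, false, 0%N) | k <- iota 1 p.-1]).
  case: c => [[[e j] d] z] /= ->; rewrite !all_cat /=.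
  by rewrite !all_braided => [|k _|k _] /=; rewrite !xpair_eqE /= !andbF.
have plainC (c : bool * bool * bool * bool) e d ls :
    (e, false, d, true) != c -> all (fun x => code x != c) (plain e d ls).
  by move=> H; apply: all_plain => l _ /=; rewrite andbF.
have twistC (c : bool * bool * bool * bool) e d ls :
    (e, false, d, false) != c -> all (fun x => code x != c) (twist e d ls).
  by move=> H; apply: all_twist => l _ [] // k _ /=; rewrite andbF.
have plainE e d ls : all (fun x => code x == (e, false, d, true)) (plain e d ls).
  by apply: all_plain => l _ /=; rewrite andbF.
have twistE e d ls : all (fun x => code x == (e, false, d, false)) (twist e d ls).
  by apply: all_twist => l _ [] // k _ /=; rewrite andbF.
have u_uniq : uniq params_u.
  apply: (step _ _ _ (plainE _ _ _)); last 1 first; rewrite ?plain_uniq //.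
    apply: (step _ _ _ (twistE _ _ _)); last 1 first; rewrite ?twist_uniq //.
      apply: (step _ _ _ (plainE _ _ _)); last 1 first; rewrite ?plain_uniq //.
        apply: (step _ _ _ (twistE _ _ _)); last 1 first; rewrite ?twist_uniq //.
          apply: (step (false, true, false, true)); rewrite ?braided_uniq //.
          - exact: all_braided.
          - by rewrite all_cat /= all_braided.
          apply: (step (true, true, false, true)); rewrite ?braided_uniq //.
          by apply: all_braided => k; rewrite mem_iota1; case: k.
        exact: nil_braided.
      by rewrite all_cat twistC // nil_braided.
    by rewrite all_cat plainC // all_cat twistC // nil_braided.
  by rewrite all_cat twistC // all_cat plainC // all_cat twistC // nil_braided.
case: B; rewrite /params ?cats0 //.
have isd_plain e ls : all (fun x : param => x.1.2) (plain e true ls) by exact: all_plain.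
have isd_twist e ls : all (fun x : param => x.1.2) (twist e true ls) by exact: all_twist.
apply: (@uniq_cat_pred _ (fun x : param => ~~ x.1.2)) => //.
- by rewrite !all_cat; do ?[apply/andP; split];
    do ?[exact: all_plain | exact: all_twist | exact: all_braided].
- rewrite (eq_all (a2 := fun x : param => x.1.2)); last by move=> x /=; rewrite negbK.
  by rewrite !all_cat !isd_plain !isd_twist.
apply: (step _ _ _ (plainE _ _ _)); last 1 first; rewrite ?plain_uniq //.
  apply: (step _ _ _ (twistE _ _ _)); last 1 first; rewrite ?twist_uniq //.
    by apply: (step _ _ _ (plainE _ _ _)); rewrite ?plain_uniq ?twist_uniq ?twistC.
  by rewrite all_cat plainC // twistC.
by rewrite all_cat twistC // all_cat plainC // twistC.
Qed.

End Params.

(** * Classification over abstract rings, for twisting of order [p] and of order [p ^ 2] *)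

Section Classification.

Variables (p q : nat) (R Z : finComUnitRingType).
Hypotheses (HR : Zsq q R) (HZ : Zsq p Z) (p_odd : odd p) (q_odd : odd q).
Hypothesis neq_pq : p != q.

Let p_prime := Zsq_prime HZ.
Let q_prime := Zsq_prime HR.
Let p_gt0 := prime_gt0 p_prime.
Let p2_gt1 : (1 < p ^ 2)%N.
Proof. by rewrite -(exp1n 2) ltn_sqr prime_gt1. Qed.
Let q_ndvd_p2 := q_ndvd_p2 HR HZ neq_pq.

Lemma q_neq0 : q%:R != 0 :> R.
Proof.
rewrite (Zsq_nat_eq0 HR); apply/negP => /(dvdn_leq (prime_gt0 q_prime)).
by rewrite -{2}(expn1 q) leq_exp2l // prime_gt1.
Qed.

(* The isomorphism from [b + b' + k p b b'] to addition. *)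
Definition log (k : nat) (b : Z) : Z :=
  if k == 0%N then b else k%:R * b - p%:R * (k%:R * b) * (k%:R * b - 1) / 2%:R.

(** The linear coefficient of [log k] modulo [p]. *)
Definition slope (k : nat) : Z := if k == 0%N then 1 else k%:R.

Lemma slope_unit k : (k < p)%N -> slope k \is a GRing.unit.
Proof.
rewrite /slope; case: eqP => [_ _|/eqP k0 kp]; first exact: unitr1.
by rewrite (Zsq_unit_nat HZ) gtnNdvd // lt0n.
Qed.

Lemma log_circ k b b' :
  log k (b + b' + p%:R * k%:R * b * b') = log k b + log k b'.
Proof.
rewrite /log; case: eqP => [->|_]; first by rewrite mulr0 !mul0r addr0.
have pp := Zsq_char HZ; have := mulVr (Zsq_unit2 HZ p_odd).
set P : Z := p%:R in pp *; set B := k%:R * b; set B' := k%:R * b'.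
have -> : k%:R * (b + b' + P * k%:R * b * b') = B + B' + P * B * B' by rewrite /B /B'; ring.
set h := 2^-1; move: (B) (B') => x y h2.
transitivity (x - P * x * (x - 1) * h + (y - P * y * (y - 1) * h) + P * x * y * (1 - h * 2)
  - P * P * h * x * y * (2 * (x + y) - 1 + P * x * y)).
  by ring.
by rewrite pp h2; ring.
Qed.

Lemma log_mulp k b : p%:R * log k b = p%:R * (slope k * b).
Proof.
rewrite /log /slope; case: eqP => _; first by rewrite mul1r.
transitivity (p%:R * (k%:R * b) - p%:R * p%:R * ((k%:R * b) * (k%:R * b - 1) / 2%:R)).
  by move: (2%:R^-1) => h; ring.
by rewrite (Zsq_char HZ); ring.
Qed.

(** The correction [(k - 1) / 2] comes from the quadratic term of [log k] at 1; the formula shows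
    which [be] realises a given exponent. *)
Lemma log1p k s : log k (1 + p%:R * s) =
  slope k * (1 + p%:R * (s - (if k == 0%N then 0 else (k%:R - 1) / 2%:R))).
Proof.
rewrite /log /slope; case: eqP => _; first by ring.
move: (2%:R^-1) => h; have pp := Zsq_char HZ.
transitivity (k%:R * (1 + p%:R * (s - (k%:R - 1) * h)) - p%:R * p%:R *
   (k%:R * s * (2 * k%:R - 1 + p%:R * k%:R * s) * h)).
  by ring.
by rewrite pp; ring.
Qed.

Lemma log0 k : log k 0 = 0.
Proof. by rewrite /log; case: eqP => // _; rewrite !mulr0 !mul0r subr0. Qed.

Section OrderP.

Variables (u v : {unit R}) (U V : Z -> R).
Hypotheses (UE : forall n, U n%:R = val u ^+ n) (u_order : #[u]%g = p).

Let U0 := char0 UE.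
Let UD := charD HZ UE.
Let u_ndvd : ~~ (q %| #[u]%g)%N.
Proof. by rewrite u_order dvdn_prime2 // eq_sym. Qed.
Let U1 : 1 - U 1 \is a GRing.unit.
Proof. by apply: (char_unit HR UE u_ndvd); rewrite u_order prime_gt1. Qed.
Let Up b : U (p%:R * b) = 1.
Proof. exact: (char_pmul HZ UE). Qed.

Variable B : bool.
Hypothesis vB : B -> #[v]%g = (p ^ 2)%N /\ forall n, V n%:R = val v ^+ n.
Hypothesis uB : ~~ B -> forall y : R, y ^+ (p ^ 2) = 1 -> y ^+ p = 1.

(** Powers of [u] depend on the exponent modulo [p] only, so there [log k] is replaced by its linear
    part. *)
Definition coef (k : nat) (d : bool) (l : nat) (b : Z) : R :=
  if d then V (l%:R * log k b) else U (l%:R * slope k * b).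

Definition param_law (x : param) : R * Z -> R * Z -> R * Z :=
  let: (e, j, k, d, l) := x in
  law p U e (if j then eps U e else coef k d l) (if j then q%:R else 0) k%:R.

Lemma coef_char k (d : bool) l : (d -> B) -> circ_char p k%:R (coef k d l).
Proof.
rewrite /coef; case: d => [/(_ isT)/vB[v_order VE]|_]; split=> [|b b'].
- by rewrite log0 mulr0 (char0 VE).
- by rewrite log_circ mulrDr (charD HZ VE).
- by rewrite mulr0 U0.
have -> : l%:R * slope k * (b + b' + p%:R * k%:R * b * b') =
    l%:R * slope k * b + l%:R * slope k * b' + p%:R * (l%:R * slope k * k%:R * b * b') by ring.
by rewrite !UD Up mulr1.
Qed.

Lemma param_law_data (e j : bool) k d l : valid p B (e, j, k, d, l) ->
  law_data p q U e (if j then eps U e else coef k d l) (if j then q%:R else 0) k%:R.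
Proof.
move=> /and4P[_ _ jP dP].
have dB : d -> B by case: (d) dP => // /andP[].
have [t0 tM] : circ_char p k%:R (if j then eps U e else coef k d l).
  by case: (j); [exact: (eps_char HZ U0 UD e (Up _)) | exact: coef_char].
split=> //; first by case: (j); [exists 1; rewrite mulr1 | exists 0; rewrite mulr0].
by case: (j) => b //; rewrite !mul0r.
Qed.

(** The [p]-th power kills all powers of [u], but not a power of [v] with [0 < l < p] and unit
    argument; this determines [d]. Then [l] is read off modulo [p], where [be] is 1. *)
Lemma coef_inj k (d : bool) l (d' : bool) l' be : (k < p)%N -> (l < p)%N -> (l' < p)%N ->
  (d -> B && (0 < l)%N) -> (d' -> B && (0 < l')%N) -> U be = U 1 ->
  coef k d l 1 = coef k d' l' be -> d = d' /\ l = l'.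
Proof.
move=> kp lp l'p dP d'P be_fix.
have V_neq1 l0 b : (0 < l0 < p)%N -> B -> b \is a GRing.unit ->
    V (l0%:R * log k b) ^+ p = 1 -> False.
  move=> /andP[l0_gt0 l0p] /vB[v_order VE] b_unit.
  rewrite -(E_nat (char0 VE) (charD HZ VE)) -(char0 VE) => /(char_inj HZ VE v_order).
  rewrite mulrCA log_mulp mulrCA -(mulr0 (p%:R)) mulrA => h.
  have : p%:R * l0%:R = p%:R * 0%:R :> Z.
    apply: (mulIr (_ : slope k * b \is a GRing.unit)).
      by rewrite unitrM slope_unit.
    by rewrite h mulr0n !mulr0 mul0r.
  by move=> /(Zsq_pmul_inj HZ l0p p_gt0) l00; rewrite l00 in l0_gt0.
have be_unit : be \is a GRing.unit.
  have [s ->] := E_fix HZ U0 UD U1 be_fix; exact: (Zsq_unit1D HZ).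
have Upow b : U b ^+ p = 1 by rewrite -(E_nat U0 UD) Up.
rewrite /coef; case: d dP; case: d' d'P => d'P dP h.
- have /andP[BT l_gt0] := dP isT; have /andP[_ l'_gt0] := d'P isT.
  have [v_order VE] := vB BT; split=> //.
  apply: (Zsq_pmul_inj HZ lp l'p); have := char_inj HZ VE v_order h.
  move=> /(congr1 (fun x => p%:R * x)).
  rewrite mulrCA log_mulp [RHS]mulrCA log_mulp.
  rewrite [slope k * be]mulrC (p_fix HZ U0 UD U1 _ be_fix) mulr1 ![_%:R * (p%:R * _)]mulrCA !mulrA.
  by move/(mulIr (slope_unit kp)).
- have /andP[BT l_gt0] := dP isT.
  case: (@V_neq1 l 1) => //; [by rewrite l_gt0 | exact: unitr1 | by rewrite h Upow].
- have /andP[BT l_gt0] := d'P isT.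
  by case: (@V_neq1 l' be) => //; [rewrite l_gt0 | rewrite -h Upow].
- split=> //; apply: (Zsq_pmul_inj HZ lp l'p).
  have := char_eq_p HZ UE u_order h.
  rewrite [_ * be]mulrC (p_fix HZ U0 UD U1 _ be_fix) mulr1 !mulrA.
  by move/(mulIr (slope_unit kp)).
Qed.

Lemma param_law_inj x y : valid p B x -> valid p B y ->
  skew_brace_iso (tadd U) (param_law x) (tadd U) (param_law y) -> x = y.
Proof.
case: x => -[[[e j] k] d] l; case: y => -[[[e' j'] k'] d'] l' xv yv.
have xd := param_law_data xv; have yd := param_law_data yv.
move=> /(law_iso_invariants HR HZ p_odd neq_pq U0 UD U1 xd yd)[<- kk jj [be be_fix tt']].
move: xv yv => /and4P[kp lp jP dP] /and4P[k'p l'p j'P d'P].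
have {kk} kk : k = k' by exact: (Zsq_pmul_inj HZ kp k'p kk).
have {jj} jj : j = j'.
  by move: jj; case: (j); case: (j') => //; rewrite eqxx (negbTE q_neq0).
rewrite -{}kk -{}jj in j'P tt' *; case: j jP j'P tt' {xd yd} => [|_ _ tt'].
  by move=> /andP[/negbTE-> /eqP->] /andP[/negbTE-> /eqP->].
have tt1 : coef k d l 1 = coef k d' l' be by rewrite tt' mulr1.
by have [-> ->] := coef_inj kp lp l'p (implyP dP) (implyP d'P) be_fix tt1.
Qed.

(** A character is determined by [t 1], a [p ^ 2]-torsion element: a power of [u] if it is
    [p]-torsion, and otherwise a power of [v]. *)
Lemma coef_surj k t : (k < p)%N -> circ_char p k%:R t ->
  exists d l be, [/\ (l < p)%N, d ==> B && (0 < l)%N, U be = U 1 &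
    forall b, t b = coef k d l (be * b)].
Proof.
move=> kp tP.
(* Up to the unit [slope k], the exponent is split as [n + p c]: [n] becomes the parameter [l],
   while [c] is lost for powers of [u] and absorbed by [be] for powers of [v]. *)
have residue (m : Z) : exists n (c : Z), (n < p)%N /\ m = (n%:R + p%:R * c) * slope k.
  have [n nE] := Zsq_natP HZ (m / slope k).
  exists (n %% p)%N, (n %/ p)%:R; split; first by rewrite ltn_mod.
  rewrite -natrM -natrD mulnC addnC -divn_eq -nE divrK // slope_unit //.
have [tp|tp] := eqVneq (t 1 ^+ p) 1.
  have [m mE] : exists m, t 1 = U m by apply: (char_surj HR UE) => //; rewrite u_order.
  have [n [c [np mnE]]] := residue m.
  exists false, n, 1; split=> // b; rewrite mul1r; move: b.
  apply: (circ_char_eq HZ p_odd tP (coef_char _ _ _)) => //.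
  rewrite mE mnE /coef mulr1 mulrDl UD -mulrA Up mulr1 //.
have BT : B.
  apply: contraNT tp => /uB ->//; exact: (circ_char_torsion HZ p_odd tP).
have [v_order VE] := vB BT.
have [m mE] : exists m, t 1 = V m.
  apply: (char_surj HR VE); rewrite v_order //; exact: (circ_char_torsion HZ p_odd tP).
have [n [c [np mnE]]] := residue m.
have n_gt0 : (0 < n)%N.
  rewrite lt0n; apply: contraNneq tp => n0.
  rewrite mE -(E_nat (char0 VE) (charD HZ VE)) mnE n0 add0r -mulrA mulrA (Zsq_char HZ) mul0r.
  by rewrite (char0 VE).
have n_unit : n%:R \is a @GRing.unit Z by rewrite (Zsq_unit_nat HZ) gtnNdvd.
(* Solves [n (s - correction) = c], with the correction of [log1p]. *)
pose s := c / n%:R + (if k == 0%N then 0 else (k%:R - 1) / 2%:R).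
have be_fix : U (1 + p%:R * s) = U 1 by rewrite UD Up mulr1.
exists true, n, (1 + p%:R * s); split; rewrite ?BT //.
apply: (circ_char_eq HZ p_odd tP).
  exact: (circ_char_mul HZ U0 UD U1 (coef_char _ _ _)).
rewrite mulr1 mE mnE /coef log1p /s addrK; congr V.
by rewrite [RHS]mulrCA [RHS]mulrC mulrDr mulr1 [n%:R * (_ * _)]mulrCA [n%:R * _]mulrC divrK.
Qed.

Lemma param_law_surj mul : is_skew_brace (tadd U) mul ->
  exists2 x, x \in params p B & skew_brace_iso (tadd U) mul (tadd U) (param_law x).
Proof.
move=> /(skew_brace_normal HR HZ p_odd q_odd neq_pq U0 UD U1)[e [j [t [k0 [ld tj iso]]]]].
have [k [kp kE]] : exists k : nat, (k < p)%N /\ p%:R * k0 = p%:R * k%:R.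
  have [n ->] := Zsq_natP HZ k0; exists (n %% p)%N; split; first by rewrite ltn_mod.
  rewrite -!natrM -(Zsq_mod_nat HZ) -[in RHS](Zsq_mod_nat HZ).
  by rewrite -mulnn -!muln_modr modn_mod.
have tP : circ_char p k%:R t.
  by have [t0 tM] := law_data_char ld; split=> // b b'; rewrite -kE tM.
case: j => [|] in ld tj iso *.
  exists (e, true, k, false, 0%N); first by apply: mem_params; rewrite //= kp p_gt0.
  apply: skew_brace_iso_trans iso _.
  apply: (@law_iso_scale p R Z HZ U U0 UD U1 _ _ _ _ _ _ _ 1 1) => //.
  - exact: unitr1.
  - by rewrite mulr1.
  - by move=> b; rewrite mul1r tj.
have [d [l [be [lp dP be_fix tE]]]] := coef_surj kp tP.
exists (e, false, k, d, l); first by apply: mem_params; rewrite //= kp lp dP.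
apply: skew_brace_iso_trans iso _.
apply: (@law_iso_scale p R Z HZ U U0 UD U1 _ _ _ _ _ _ _ 1 be) => //.
- exact: unitr1.
- by rewrite mul0r.
Qed.

Lemma classifies_param_law :
  classifies (tadd U) (if B then 4 * p ^ 2 else 2 * p ^ 2 + 2 * p)%N
    (map param_law (params p B)).
Proof.
apply: classifies_map; first exact: size_params.
- exact: params_uniq.
- move=> [[[[e j] k] d] l] /(params_valid p_gt0)/param_law_data.
  exact: (law_is_brace HR HZ p_odd U0 UD).
- by move=> x y /(params_valid p_gt0) xv /(params_valid p_gt0); exact: param_law_inj.
- exact: param_law_surj.
Qed.

End OrderP.

Section OrderP2.

Variables (v : {unit R}) (V : Z -> R).
Hypotheses (VE : forall n, V n%:R = val v ^+ n) (v_order : #[v]%g = (p ^ 2)%N).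

Let V0 := char0 VE.
Let VD := charD HZ VE.
Let v_ndvd : ~~ (q %| #[v]%g)%N.
Proof. by rewrite v_order. Qed.
Let V1 : 1 - V 1 \is a GRing.unit.
Proof. by apply: (char_unit HR VE v_ndvd); rewrite v_order. Qed.
Let V_inj : injective V := char_inj HZ VE v_order.

Definition params2 : seq (bool * bool * nat) :=
  [seq (false, false, l) | l <- iota 0 (p ^ 2)] ++
  [seq (true, false, l) | l <- iota 0 (p ^ 2)] ++
  [:: (false, true, 0%N); (true, true, 0%N)].

Definition coef2 (l : nat) (b : Z) : R := V (l%:R * b).

Definition param_law2 (x : bool * bool * nat) : R * Z -> R * Z -> R * Z :=
  let: (e, j, l) := x in
  law p V e (if j then eps V e else coef2 l) (if j then q%:R else 0) 0.

Lemma mem_params2 (e j : bool) l :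
  ((e, j, l) \in params2) = if j then l == 0%N else (l < p ^ 2)%N.
Proof.
have memE (e' : bool) : ((e, j, l) \in [seq (e', false, l) | l <- iota 0 (p ^ 2)]) =
    [&& e == e', ~~ j & (l < p ^ 2)%N].
  apply/mapP/and3P => [[l' l'_in [-> -> ->]]|[/eqP-> /negbTE-> l_p]].
    by move: l'_in; rewrite mem_iota.
  by exists l; rewrite ?mem_iota.
by rewrite !mem_cat !memE !inE !xpair_eqE; case: (e); case: (j); rewrite ?orbF.
Qed.

Lemma size_params2 : size params2 = (2 * p ^ 2 + 2)%N.
Proof. by rewrite !size_cat !size_map !size_iota addnA mul2n addnn. Qed.

Lemma params2_uniq : uniq params2.
Proof.
have u e : uniq [seq (e, false, l) : bool * bool * nat | l <- iota 0 (p ^ 2)].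
  by rewrite map_inj_uniq ?iota_uniq // => l l' [].
rewrite /params2 catA; apply: (@uniq_cat_pred _ (fun x => ~~ x.1.2)) => //.
  by rewrite all_cat; apply/andP; split; apply/allP => x /mapP[l _ ->].
apply: (@uniq_cat_pred _ (fun x => ~~ x.1.1)) => //.
  by apply/allP => x /mapP[l _ ->].
by apply/allP => x /mapP[l _ ->].
Qed.

Lemma coef2_char l : circ_char p 0 (coef2 l).
Proof.
split=> [|b b']; rewrite /coef2 ?mulr0 // !mul0r addr0.
by rewrite mulrDr VD.
Qed.

Lemma param_law2_data (e j : bool) l :
  law_data p q V e (if j then eps V e else coef2 l) (if j then q%:R else 0) 0.
Proof.
have Vp0 : V (p%:R * 0) = 1 by rewrite mulr0.
have [t0 tM] : circ_char p 0 (if j then eps V e else coef2 l).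
  by case: j; [exact: (eps_char HZ V0 VD e Vp0) | exact: coef2_char].
split=> //; first by case: j {t0 tM}; [exists 1; rewrite mulr1 | exists 0; rewrite mulr0].
by case: j {t0 tM} => b //; rewrite !mul0r.
Qed.

(** Here [V] is injective, so [V be = V 1] forces [be = 1] and [t] itself is an invariant. *)
Lemma param_law2_inj x y : x \in params2 -> y \in params2 ->
  skew_brace_iso (tadd V) (param_law2 x) (tadd V) (param_law2 y) -> x = y.
Proof.
case: x => -[e j] l; case: y => -[e' j'] l'; rewrite !mem_params2 => lp l'p.
move=> /(law_iso_invariants HR HZ p_odd neq_pq V0 VD V1 (param_law2_data e j l)
  (param_law2_data e' j' l'))[<- _ jj [be /V_inj-> tt']].
have {jj} jj : j = j'.
  by move: jj; case: (j); case: (j') => //; rewrite eqxx (negbTE q_neq0).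
rewrite -{}jj in l'p tt' *; case: j lp l'p tt' => [/eqP-> /eqP-> //|lp l'p tt'].
have := tt' 1; rewrite /coef2 !mulr1 => /(char_eq VE).
by rewrite v_order !modn_small // => ->.
Qed.

(** Injectivity of [V] turns [V (p k) = 1] into [p k = 0], so the second coordinate is purely
    additive. *)
Lemma param_law2_surj mul : is_skew_brace (tadd V) mul ->
  exists2 x, x \in params2 & skew_brace_iso (tadd V) mul (tadd V) (param_law2 x).
Proof.
move=> /(skew_brace_normal HR HZ p_odd q_odd neq_pq V0 VD V1)[e [j [t [k [ld tj iso]]]]].
have [Ek t0 tM _ _] := ld.
have pk : p%:R * k = p%:R * 0 by rewrite mulr0; apply: V_inj; rewrite Ek V0.
have tP : circ_char p 0 t by split=> // b b'; rewrite -pk tM.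
have scale J t' : t =1 t' -> skew_brace_iso (tadd V) (law p V e t J k) (tadd V) (law p V e t' J 0).
  move=> tt'; apply: (@law_iso_scale p R Z HZ V V0 VD V1 _ _ _ _ _ _ _ 1 1) => //.
  - exact: unitr1.
  - by rewrite mulr1.
  - by move=> b; rewrite mul1r tt'.
case: j => [|] in ld tj iso *.
  exists (e, true, 0%N); first by rewrite mem_params2.
  by apply: skew_brace_iso_trans iso (scale _ _ _); exact: tj.
have [m mE] : exists m, t 1 = V m.
  apply: (char_surj HR VE) => //; rewrite v_order; exact: (circ_char_torsion HZ p_odd tP).
have [n nE] := Zsq_natP HZ m.
exists (e, false, (n %% p ^ 2)%N).
  by rewrite mem_params2 ltn_mod (ltnW p2_gt1).
apply: skew_brace_iso_trans iso (scale _ _ _).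
apply: (circ_char_eq HZ p_odd tP (coef2_char _)).
by rewrite /coef2 mulr1 (Zsq_mod_nat HZ) -nE.
Qed.

Lemma classifies_param_law2 :
  classifies (tadd V) (2 * p ^ 2 + 2)%N (map param_law2 params2).
Proof.
apply: classifies_map; first exact: size_params2.
- exact: params2_uniq.
- by move=> [[e j] l] _; exact: (law_is_brace HR HZ p_odd V0 VD (param_law2_data e j l)).
- exact: param_law2_inj.
- exact: param_law2_surj.
Qed.

End OrderP2.

End Classification.

(** * Closed forms of the laws *)

Section LawShape.

Variables (p q : nat) (R Z : finComUnitRingType) (E t t' : Z -> R).
Hypothesis tt' : t =1 t'.

Let ext2 (f g : R * Z -> R * Z -> R * Z) :
  (forall a b a' b', f (a, b) (a', b') = g (a, b) (a', b')) -> f = g.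
Proof.
move=> fg; apply: functional_extensionality => -[a b].
by apply: functional_extensionality => -[a' b']; exact: fg.
Qed.

Lemma law_plain :
  law p E false t 0 0 = fun '(a, b) '(a', b') => (a + t' b * a', b + b').
Proof. by apply: ext2 => a b a' b'; rewrite /law /= tt'; congr pair; ring. Qed.

Lemma law_plain_E :
  law p E true t 0 0 = fun '(a, b) '(a', b') => (E b' * a + t' b * a', b + b').
Proof. by apply: ext2 => a b a' b'; rewrite /law /= tt'; congr pair; ring. Qed.

Lemma law_twist (k : Z) :
  law p E false t 0 k =
  fun '(a, b) '(a', b') => (a + t' b * a', b + b' + k * p%:R * b * b').
Proof. by apply: ext2 => a b a' b'; rewrite /law /= tt'; congr pair; ring. Qed.

Lemma law_twist_E (k : Z) :
  law p E true t 0 k =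
  fun '(a, b) '(a', b') => (E b' * a + t' b * a', b + b' + k * p%:R * b * b').
Proof. by apply: ext2 => a b a' b'; rewrite /law /= tt'; congr pair; ring. Qed.

Lemma law_braided (k : Z) :
  law p E false (eps E false) q%:R k =
  fun '(a, b) '(a', b') =>
    (a + a' + q%:R * a * a', b + b' + k * p%:R * b * b').
Proof. by apply: ext2 => a b a' b'; rewrite /law /=; congr pair; ring. Qed.

Lemma law_braided_E (k : Z) :
  law p E true (eps E true) q%:R k =
  fun '(a, b) '(a', b') =>
    (E b' * a + E b * a' + q%:R * a * a', b + b' + k * p%:R * b * b').
Proof. by apply: ext2 => a b a' b'; rewrite /law /=; congr pair; ring. Qed.

Lemma law_braided0 :
  law p E false (eps E false) q%:R 0 =
  fun '(a, b) '(a', b') => (a + a' + q%:R * a * a', b + b').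
Proof. by apply: ext2 => a b a' b'; rewrite /law /=; congr pair; ring. Qed.

Lemma law_braided0_E :
  law p E true (eps E true) q%:R 0 =
  fun '(a, b) '(a', b') => (E b' * a + E b * a' + q%:R * a * a', b + b').
Proof. by apply: ext2 => a b a' b'; rewrite /law /=; congr pair; ring. Qed.

End LawShape.

(** * Specialisation to [Z/q^2] and [Z/p^2] *)

Section Instance.

Variables p q : nat.

Notation R := ('Z_(q ^ 2)).
Notation Z := ('Z_(p ^ 2)).

Lemma twisted_addE (u : {unit R}) :
  @twisted_add p q u = @tadd R Z (@zpow (q ^ 2) (p ^ 2) u).
Proof.
apply: functional_extensionality => -[a b].
by apply: functional_extensionality => -[a' b'].
Qed.

Lemma map_plain (T : Type) (F : param -> T) e d ls :
  map F (plain e d ls) = [seq F (e, false, 0%N, d, l) | l <- ls].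
Proof. by rewrite -map_comp. Qed.

Lemma map_twist (T : Type) (F : param -> T) e d ls :
  map F (twist p e d ls) =
  [seq F (e, false, k, d, l) | l <- ls, k <- iota 1 p.-1].
Proof. by rewrite map_allpairs. Qed.

Lemma eq_allpairs_iota1 (T : Type) (f g : nat -> nat -> T) ls :
  (forall l k, (k == 0%N) = false -> f l k = g l k) ->
  [seq f l k | l <- ls, k <- iota 1 p.-1] = [seq g l k | l <- ls, k <- iota 1 p.-1].
Proof.
move=> fg; congr flatten; apply: eq_map => l.
by apply/eq_in_map => k; rewrite mem_iota => /andP[k_gt0 _]; rewrite fg // gtn_eqF.
Qed.

Section Laws.

Variables (u v : {unit R}).

Let F := @param_law p q R Z (@zpow (q ^ 2) (p ^ 2) u) (@zpow (q ^ 2) (p ^ 2) v).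

Lemma laws_order_pE : laws_order_p p u = map F (params_u p).
Proof.
rewrite /params_u !map_cat !map_plain !map_twist; do ?congr (_ ++ _).
- apply: eq_map => l; apply/esym/law_plain => b.
  by rewrite /coef /slope /= mulr1.
- apply: eq_allpairs_iota1 => l k k0; apply/esym/law_twist => b.
  by rewrite /coef /slope k0.
- apply: eq_map => l; apply/esym/law_plain_E => b.
  by rewrite /coef /slope /= mulr1.
- apply: eq_allpairs_iota1 => l k k0; apply/esym/law_twist_E => b.
  by rewrite /coef /slope k0.
- by rewrite -map_comp; apply: eq_map => k; apply/esym/law_braided.
- by congr [:: _]; apply/esym/law_braided0_E.
- by rewrite -map_comp; apply: eq_map => k; apply/esym/law_braided_E.
Qed.

Lemma laws_order_p_extraE : laws_order_p_extra p u v = map F (params_v p).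
Proof.
rewrite /params_v !map_cat !map_plain !map_twist; do ?congr (_ ++ _).
- by apply: eq_map => l; apply/esym/law_plain => b.
- apply: eq_allpairs_iota1 => l k k0; apply/esym/law_twist => b.
  by rewrite /coef /log k0.
- by apply: eq_map => l; apply/esym/law_plain_E => b.
- apply: eq_allpairs_iota1 => l k k0; apply/esym/law_twist_E => b.
  by rewrite /coef /log k0.
Qed.

Lemma laws_order_p2E :
  laws_order_p2 p v =
  map (@param_law2 p q R Z (@zpow (q ^ 2) (p ^ 2) v)) (params2 p).
Proof.
rewrite /params2 !map_cat -!map_comp; do ?congr (_ ++ _).
- by apply: eq_map => l; apply/esym/law_plain => b.
- by apply: eq_map => l; apply/esym/law_plain_E => b.
- by congr [:: _; _]; apply/esym; [exact: law_braided0 | exact: law_braided0_E].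
Qed.

End Laws.

Hypotheses (p_prime : prime p) (q_prime : prime q).

Let p2_gt1 : (1 < p ^ 2)%N.
Proof. by rewrite -(exp1n 2) ltn_sqr prime_gt1. Qed.

(** Reducing the exponent modulo [p ^ 2] is harmless because the order of [u] divides [p ^ 2]. *)
Lemma zpow_nat (u : {unit R}) n : (#[u]%g %| p ^ 2)%N ->
  zpow u (n%:R : Z) = val u ^+ n.
Proof.
move=> u_p2; rewrite /zpow -FinRing.val_unitX val_Zp_nat //; congr val.
by apply/eqP; rewrite eq_expg_mod_order modn_dvdm.
Qed.

(** The order of [y] divides both [p ^ 2] and [(q - 1) q], the order of the unit group. If it were
    [p ^ 2], which is prime to [q], it would divide [q - 1]. *)
Lemma p2_torsion_p (y : R) : p != q -> ~~ (p ^ 2 %| q - 1)%N ->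
  y ^+ (p ^ 2) = 1 -> y ^+ p = 1.
Proof.
move=> neq_pq p2_ndvd yp2.
have y_unit : y \is a GRing.unit.
  by rewrite -(unitrX_pos _ (_ : 0 < p ^ 2)%N) ?yp2 ?unitr1 // ltnW.
pose w : {unit R} := FinRing.unit R y_unit.
have w_ord : (#[w]%g %| p ^ 2)%N.
  by rewrite order_dvdn; apply/eqP/val_inj; rewrite FinRing.val_unitX.
have w_card : (#[w]%g %| q.-1 * q)%N.
  rewrite (_ : (q.-1 * q)%N = totient (q ^ 2)); last by rewrite totient_pfactor // expn1.
  by rewrite -card_units_Zp ?expn_gt0 ?prime_gt0 // order_dvdG // in_setT.
have wp : (#[w]%g %| p)%N.
  have /(dvdn_pfactor _ _ p_prime)[[|[|[|i]]] // _ wE] := w_ord; rewrite wE //.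
  case/negP: p2_ndvd; rewrite subn1 -(@Gauss_dvdl _ _ q) -?wE //.
  by rewrite wE coprime_pexpl // prime_coprime // dvdn_prime2.
move: wp; rewrite order_dvdn => /eqP/(congr1 val).
by rewrite FinRing.val_unitX.
Qed.

End Instance.

Local Close Scope ring_scope.

Theorem proposition11 (p q : nat) (p_prime : prime p) (q_prime : prime q)
    (p_odd : odd p) (q_odd : odd q) (p_dvd : p %| q - 1)
    (u : {unit 'Z_(q ^ 2)}) (u_order : #[u]%g = p) :
  [/\ ~~ (p ^ 2 %| q - 1) ->
        classifies (@twisted_add p q u) (2 * p ^ 2 + 2 * p)
          (laws_order_p p u),
      p ^ 2 %| q - 1 ->
        forall u' : {unit 'Z_(q ^ 2)}, #[u']%g = p ^ 2 ->
        classifies (@twisted_add p q u) (4 * p ^ 2)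
          (laws_order_p p u ++ laws_order_p_extra p u u')
    & p ^ 2 %| q - 1 ->
        forall u' : {unit 'Z_(q ^ 2)}, #[u']%g = p ^ 2 ->
        classifies (@twisted_add p q u') (2 * p ^ 2 + 2)
          (laws_order_p2 p u')].
Proof.
have neq_pq : p != q.
  apply/eqP => pq; have := dvdn_leq _ p_dvd; rewrite pq subn_gt0 prime_gt1 //.
  by move=> /(_ isT); rewrite leqNgt subn1 prednK ?leqnn ?prime_gt0.
have HR := Zsq_Zp q_prime; have HZ := Zsq_Zp p_prime.
have uE n : zpow u (n%:R : 'Z_(p ^ 2))%R = (val u ^+ n)%R.
  by apply: zpow_nat => //; rewrite u_order dvdn_exp.
split=> [p2_ndvd|p2_dvd v v_order|p2_dvd v v_order]; rewrite twisted_addE.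
(* With [B] false no power of the second unit is listed, so [u] itself fills its place. *)
- have := @classifies_param_law p q _ _ HR HZ p_odd q_odd neq_pq u u _
    (@zpow (q ^ 2) (p ^ 2) u) uE u_order false.
  rewrite /params cats0 (@laws_order_pE p q u u); apply=> // _ y.
  exact: p2_torsion_p.
- have vE n : zpow v (n%:R : 'Z_(p ^ 2))%R = (val v ^+ n)%R.
    by apply: zpow_nat => //; rewrite v_order.
  have := @classifies_param_law p q _ _ HR HZ p_odd q_odd neq_pq u v _
    (@zpow (q ^ 2) (p ^ 2) v) uE u_order true.
  by rewrite /params map_cat -laws_order_pE -laws_order_p_extraE; apply.
- have vE n : zpow v (n%:R : 'Z_(p ^ 2))%R = (val v ^+ n)%R.
    by apply: zpow_nat => //; rewrite v_order.
  by rewrite laws_order_p2E; exact: (classifies_param_law2 HR HZ p_odd q_odd neq_pq vE v_order).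
Qed.
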